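(* Let $n$ be a positive integer and let $\mathbf{G}=\{G_1,\dots,G_{2n-1}\}$ be a collection of $2n-1$ (not necessarily distinct) bipartite graphs on the same bipartition $V=(X,Y)$ with $|X|=|Y|=n$. If $\delta(G_i)\geq\left\lceil \frac{n}{2}\right\rceil$ for each $i\in[2n-1]$, then one of the following holds: (i) $\mathbf{G}$ contains a transversal isomorphic to a Hamiltonian path, i.e. there is a path $P$ with $V(P)=V$ (so $|E(P)|=2n-1$) and an injection $\phi:E(P)\to[2n-1]$ with $e\in E(G_{\phi(e)})$ for every $e\in E(P)$; (ii) $n$ is even and $G_1=\dots=G_{2n-1}=K_{\frac{n}{2},\frac{n}{2}}\cup K_{\frac{n}{2},\frac{n}{2}}$ (the disjoint union of two complete bipartite graphs $K_{\frac n2,\frac n2}$, each with $\frac n2$ vertices in $X$ and $\frac n2$ vertices in $Y$).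
   Context: $[a]=\{1,\dots,a\}$. $\delta(G)$ is the minimum degree of $G$. For a collection $\mathbf{G}=\{G_1,\dots,G_s\}$ of graphs on a common vertex set $V$ and a graph $H$ with $V(H)\subseteq V$ and $|E(H)|\le s$, $H$ is a $\mathbf{G}$-transversal if $|E(H)|=s$ and there is an injection $\phi:E(H)\to[s]$ with $e\in E(G_{\phi(e)})$ for each $e\in E(H)$. *)

(* Defs.v *)
From mathcomp Require Import all_boot.

Set Implicit Arguments.
Unset Strict Implicit.
Unset Printing Implicit Defensive.

(* A simple graph whose vertex set is a subset of the ambient finite type V.
   The field graph_axiom is boolean, so Leibniz equality of graphs is equality
   of vertex sets and of edge sets. *)
Record graph (V : finType) := Graph {
  vertices : {set V};
  edges : {set {set V}};
  graph_axiom : [forall e in edges, (e \subset vertices) && (#|e| == 2)]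
}.

Definition degree (V : finType) (G : graph V) (v : V) : nat :=
  #|[set e in edges G | v \in e]|.

(* Every degree is less than #|vertices G|, so the default value matters only
   for the graph without vertices. *)
Definition min_degree (V : finType) (G : graph V) : nat :=
  \big[minn/#|vertices G|]_(v in vertices G) degree G v.

Definition bipartite_on (V : finType) (X Y : {set V}) (G : graph V) : Prop :=
  [/\ [disjoint X & Y], vertices G = X :|: Y &
      forall e, e \in edges G -> exists x y, [/\ x \in X, y \in Y & e = [set x; y]]].

Definition is_path (V : finType) (P : graph V) : Prop :=
  exists s : seq V,
    [/\ s <> [::], uniq s, vertices P = [set x in s] &
        edges P = [set e in [seq [set p.1; p.2] | p <- zip s (behead s)]]].

Definition graph_transversal (V : finType) (s : nat) (G : 'I_s -> graph V)
    (H : graph V) : Prop :=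
  #|edges H| = s /\
  exists phi : {e : {set V} | e \in edges H} -> 'I_s,
    injective phi /\ forall e, val e \in edges (G (phi e)).

Definition complete_bipartite (V : finType) (A B : {set V}) (K : graph V) : Prop :=
  [/\ [disjoint A & B], vertices K = A :|: B &
      edges K = [set [set a; b] | a in A, b in B]].

Definition disjoint_union (V : finType) (K1 K2 H : graph V) : Prop :=
  [/\ [disjoint vertices K1 & vertices K2],
      vertices H = vertices K1 :|: vertices K2 &
      edges H = edges K1 :|: edges K2].

(* K_{m,m} \cup K_{m,m}, each copy having m vertices in X and m in Y. *)
Definition two_complete_bipartite (V : finType) (X Y : {set V}) (m : nat)
    (H : graph V) : Prop :=
  exists (A1 B1 A2 B2 : {set V}) (K1 K2 : graph V),
    [/\ [/\ A1 \subset X, B1 \subset Y, A2 \subset X & B2 \subset Y],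
        [/\ #|A1| = m, #|B1| = m, #|A2| = m & #|B2| = m],
        complete_bipartite A1 B1 K1,
        complete_bipartite A2 B2 K2 &
        disjoint_union K1 K2 H].

(* Main.v *)
Require Import Defs.
From HB Require Import structures.
From Stdlib Require Import Classical.
From mathcomp Require Import all_boot zify.

Set Implicit Arguments.
Unset Strict Implicit.
Unset Printing Implicit Defensive.

(** Let h = ceil(n/2) and suppose that no rainbow Hamiltonian path exists. Take a rainbow path on k vertices that no rainbow path on k + 1 vertices improves.

If k = 2m is even, two unused colours a and b at the two ends give a crossing pair, which closes the path to a rainbow cycle of length 2m. No edge of an unused colour leaves the cycle, so by the degree condition m = h = n/2 and that colour is complete on both blocks; recolouring one edge of the cycle shows the same for every colour, which is the exceptional case.

If k = 2m + 1 < 2n - 1, there are two unused colours, and rotating one end in the colour a and attaching an outside vertex y in the colour b extends the path.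

If k = 2n - 1, one vertex y and one colour a are left over. Without a rainbow cycle of length 2n - 2, the first and the last edge of every such path also lie in its unused colour; playing with these recolourings lets y be attached. With such a cycle w_0 w_1 ..., leaving out x and y, count for each z the even i such that w_i z has the colour of w_i w_{i+1}. By averaging, some z = w_l has at least h such i. Opening the cycle at w_l w_{l+1} frees the colour b of that edge next to a, and the end w_l now has h rotations that cost no colour. Using these for 2-opt moves, any edge w_j w_{j+1} can be opened instead at the cost of neither a nor b, and x and y can be attached at a suitable one of them. *)

Ltac keep_arith T :=
  lazymatch T with
  | nat => idtac
  | odd _ = _ => idtac
  | @eq ?T' _ _ => unify T' nat
  | is_true (leq _ _) => idtac
  | is_true (odd _) => idtac
  | is_true (~~ odd _) => idtac
  | is_true (andb (leq _ _) (leq _ _)) => idtac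
  | is_true (~~ (@eq_op _ ?a _)) => let T' := type of a in unify T' nat
  end.

(* [lia] splits on every boolean it sees, hence the clearing and generalising. *)
Ltac nat_lia :=
  repeat match goal with
  | H : ?T |- _ => tryif keep_arith T then fail else clear H
  end;
  repeat match goal with
  | |- context [nat_of_bool ?b] =>
      lazymatch b with true => fail | false => fail | _ => generalize (nat_of_bool b); intro end
  end;
  lia.

(** * Segments of sequences and rainbow walks *)

HB.lock Definition seg (T : Type) (f : nat -> T) i j := [seq f k | k <- index_iota i j].

Section Segments.
Variable T : Type.
Implicit Types (f : nat -> T) (s : seq T).

Lemma segE f i j : seg f i j = [seq f k | k <- index_iota i j].
Proof. by rewrite unlock. Qed.

Lemma size_seg f i j : size (seg f i j) = j - i.
Proof. by rewrite !segE size_map size_iota. Qed.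

Lemma seg_split f k i j : i <= k -> k <= j -> seg f i j = seg f i k ++ seg f k j.
Proof.
move=> ik kj; rewrite !segE -map_cat /index_iota.
have -> : j - i = (k - i) + (j - k) by lia.
by rewrite iotaD subnKC.
Qed.

Lemma seg1 f i : seg f i i.+1 = [:: f i].
Proof. by rewrite !segE /index_iota subSnn. Qed.

Lemma seg_nil f i j : j <= i -> seg f i j = [::].
Proof. by rewrite -subn_eq0 !segE /index_iota => /eqP->. Qed.

Lemma eq_seg f g i j : (forall k, i <= k < j -> f k = g k) -> seg f i j = seg g i j.
Proof. by move=> fg; rewrite !segE; apply/eq_in_map => k; rewrite mem_index_iota; apply: fg. Qed.

Lemma seg_shift f r i j : seg (fun k => f (k + r)) i j = seg f (i + r) (j + r).
Proof.
rewrite !segE /index_iota subnDr [i + r]addnC iotaDl -map_comp.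
by apply/eq_map => k /=; rewrite addnC.
Qed.

Lemma seg_succ f g i j : (forall k, g k = f k.+1) -> seg f i.+1 j.+1 = seg g i j.
Proof. by move=> fg; rewrite -(addn1 i) -(addn1 j) -seg_shift; apply: eq_seg => k _; rewrite addn1. Qed.

Lemma seg_cons f i j : i < j -> seg f i j = f i :: seg f i.+1 j.
Proof. by move=> ij; rewrite (@seg_split f i.+1) // seg1. Qed.

Lemma count_seg_split p f k i j : i <= k -> k <= j ->
  count p (seg f i j) = count p (seg f i k) + count p (seg f k j).
Proof. by move=> ik kj; rewrite (seg_split f ik kj) count_cat. Qed.

Lemma count_seg_cons p f i j : i < j -> count p (seg f i j) = p (f i) + count p (seg f i.+1 j).
Proof. by move=> ij; rewrite seg_cons. Qed.

Lemma count_cons p x s : count p (x :: s) = p x + count p s.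
Proof. by []. Qed.

End Segments.
Definition countE := (count_cat, count_rev, count_cons).

Section SegmentMembership.
Variable T : eqType.
Implicit Types (f : nat -> T) (s : seq T).

(** Reduces the uniqueness of a path assembled from segments to linear arithmetic on counts. *)
Lemma uniq_countP s : reflect (forall z, count_mem z s <= 1) (uniq s).
Proof.
apply: (iffP idP) => [us z | ]; first by rewrite count_uniq_mem // leq_b1.
elim: s => //= x s IH H; rewrite IH => [|z]; last first.
  by apply: leq_trans (H z); rewrite leq_addl.
by rewrite andbT -has_pred1 has_count; have := H x; rewrite eqxx; lia.
Qed.

Lemma mem_seg f i j k : i <= k < j -> f k \in seg f i j.
Proof. by move=> H; rewrite segE; apply/mapP; exists k; rewrite ?mem_index_iota. Qed.

Lemma segP f i j x : reflect (exists2 k, i <= k < j & x = f k) (x \in seg f i j).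
Proof.
by rewrite !segE; apply: (iffP mapP) => -[k H ->]; exists k => //; move: H; rewrite mem_index_iota.
Qed.

Lemma seg_inj f j k l : uniq (seg f 0 j) -> k < j -> l < j -> f k = f l -> k = l.
Proof.
move=> uf kj lj fkl.
wlog kl : k l kj lj fkl / k < l.
  by move=> H; case: (ltngtP k l) => // ?; [apply: H|apply/esym/H].
move: uf; rewrite (seg_split f (leq0n l) (ltnW lj)) (seg_cons f lj) cat_uniq /= negb_or.
by case/and3P=> _ /andP[/negP[]]; rewrite -fkl; apply: mem_seg.
Qed.

Lemma perm_seg_period f p i : (forall k, f (k + p) = f k) -> perm_eq (seg f i (i + p)) (seg f 0 p).
Proof.
move=> fp; elim: i => // i; apply: perm_trans; case: p fp => [|p] fp.
  by rewrite !addn0 !seg_nil.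
rewrite (@seg_split _ _ i.+1 i) ?seg1 1?(@seg_split _ _ (i + p.+1) i.+1) ?addSn ?seg1; try lia.
by rewrite fp perm_catC.
Qed.

End SegmentMembership.

Section Walks.
Variables (V C : Type) (E : C -> rel V).
Hypothesis Esym : forall c, symmetric (E c).

(* The second list is the sequence of colours along the walk, so a rainbow path is a walk both of whose lists are duplicate-free. *)
Inductive walk : V -> V -> seq V -> seq C -> Prop :=
| walk_one u : walk u u [:: u] [::]
| walk_step c u v w A U : E c u v -> walk v w A U -> walk u w (u :: A) (c :: U).

Lemma walk_cat u v v' w A B U W c :
  walk u v A U -> E c v v' -> walk v' w B W -> walk u w (A ++ B) (U ++ c :: W).
Proof.
move=> H; elim: H v' B W => [x|d x y z A0 U0 Exy _ IH] v' B W Ev HB.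
  exact: walk_step HB.
exact: walk_step Exy (IH _ _ _ Ev HB).
Qed.

Lemma walk_rev u w A U : walk u w A U -> walk w u (rev A) (rev U).
Proof.
elim=> [x|c x y z A0 U0 Exy _ IH]; first exact: walk_one.
rewrite !rev_cons -!cats1; apply: walk_cat IH _ (walk_one _).
by rewrite Esym.
Qed.

Lemma walk_rcons u v w A U c : walk u v A U -> E c v w -> walk u w (rcons A w) (rcons U c).
Proof. by move=> H Ec; rewrite -!cats1; apply: walk_cat H Ec (walk_one _). Qed.

Lemma walk_seg (v : nat -> V) (c : nat -> C) i j : i <= j ->
  (forall k, i <= k < j -> E (c k) (v k) (v k.+1)) ->
  walk (v i) (v j) (seg v i j.+1) (seg c i j).
Proof.
move=> ij; rewrite -(subnKC ij); elim: (j - i) => [|d IH] H.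
  by rewrite addn0 seg1 seg_nil //; apply: walk_one.
have := walk_rcons (IH _) (H (i + d) _).
rewrite -!cats1 -!seg1 -!seg_split ?addnS; try lia.
by apply => [k Hk|]; [apply: H|]; lia.
Qed.

Lemma walk_seg_pred (v : nat -> V) (c : nat -> C) i j : i < j ->
  (forall k, i <= k -> k.+1 < j -> E (c k) (v k) (v k.+1)) ->
  walk (v i) (v j.-1) (seg v i j) (seg c i j.-1).
Proof.
case: j => // j ij H; apply: walk_seg => // k Hk.
by apply: H; lia.
Qed.

Lemma walk_size u w A U : walk u w A U -> size A = (size U).+1.
Proof. by elim=> //= c x y z A0 U0 _ _ ->. Qed.

Lemma walk_head u w A U : walk u w A U -> exists A', A = u :: A'.
Proof. by case=> [x|c x y z A0 U0 _ _]; eexists. Qed.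

(** Passes from lists to indexed vertices and colours, so that cuts and rotations become statements
    about indices. The default [c0] fills the colour function beyond the walk. *)
Lemma walkE (c0 : C) u w A U : walk u w A U ->
  exists (v : nat -> V) (c : nat -> C),
    [/\ A = seg v 0 (size U).+1, U = seg c 0 (size U), u = v 0, w = v (size U) &
        forall k, k < size U -> E (c k) (v k) (v k.+1)].
Proof.
elim=> [x|d x y z A0 U0 Exy _ [v [c [HA HU Hu Hw He]]]].
  by exists (fun=> x), (fun=> c0); split; rewrite ?seg1 ?seg_nil.
exists (fun k => if k is k'.+1 then v k' else x), (fun k => if k is k'.+1 then c k' else d).
split => //=.
- by rewrite seg_cons // HA; congr cons; rewrite (@seg_succ _ _ v).
- by rewrite seg_cons // {1}HU; congr cons; rewrite (@seg_succ _ _ c).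
- by case=> [|k] /= Hk; [rewrite -Hu|apply: He].
Qed.

End Walks.

(** * Rainbow paths in the absence of a rainbow Hamiltonian path *)

(** The pigeonhole step behind most crossing pairs below. *)
Lemma count_overlap (p q : pred nat) s d e :
  size s < d + e -> d <= count p s -> e <= count q s -> exists k, [/\ k \in s, p k & q k].
Proof.
move=> H Hd He; have {d e Hd He} H : size s < count p s + count q s by nat_lia.
rewrite -count_predUI in H; have : has (predI p q) s.
  by rewrite has_count; have := count_size (predU p q) s; nat_lia.
by case/hasP => k ks /andP[pk qk]; exists k.
Qed.

Section RainbowPaths.
Variables (V C : finType) (E : C -> rel V) (side : V -> bool) (n h : nat).
Hypothesis Esym : forall c, symmetric (E c).
Hypothesis Eside : forall c u w, E c u w -> side w = ~~ side u.
Hypothesis Edeg : forall c u, h <= #|[set z | E c u z]|.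
Hypothesis card_side : forall b, #|[set z | side z == b]| = n.
Hypothesis cardC : #|C|.+1 = n.*2.
Hypothesis n_le : n <= h.*2.
Hypothesis n_gt0 : 0 < n.

Local Notation walk := (walk E).

Implicit Types (v : nat -> V) (c : nat -> C) (a b d : C) (u w x y z : V) (A : seq V) (U : seq C).

Definition rainbow_hamiltonian :=
  exists u w A U, [/\ walk u w A U, uniq A, uniq U & size A = n.*2].

Lemma cardV : #|V| = n.*2.
Proof.
rewrite -cardsT -(cardsID [set z | side z]) setTI setTD.
have -> : [set z | side z] = [set z | side z == true] by apply/setP => z; rewrite !inE eqb_id.
have -> : ~: [set z | side z == true] = [set z | side z == false].
  by apply/setP => z; rewrite !inE; case: side.
by rewrite !card_side addnn.
Qed.

Lemma mem_full (s : seq V) z : uniq s -> size s = n.*2 -> z \in s.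
Proof.
move=> us ss; have : s =i predT by apply/subset_cardP; [rewrite (card_uniqP us) ss -cardV|apply/subset_predT].
by move->.
Qed.

(** The images under [g] of the indices satisfying [p] cover the neighbourhood of [u], which has at
    least [h] elements. *)
Lemma count_neighbours (a : C) u (g : nat -> V) (p : pred nat) r :
  (forall z, E a u z -> exists k, [/\ k < r, p k & z = g k]) ->
  h <= count p (iota 0 r).
Proof.
move=> H; apply: leq_trans (Edeg a u) _.
rewrite -size_filter -(size_map g); apply: leq_trans (card_size _).
apply/subset_leq_card/subsetP => z; rewrite inE => /H[k [kr pk ->]].
by rewrite map_f // mem_filter pk mem_iota.
Qed.

Lemma exists_neighbour (a : C) u : exists z, E a u z.
Proof.
have h0 : 0 < #|[set z | E a u z]| by apply: leq_trans (Edeg a u); nat_lia.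
by case/card_gt0P: h0 => z; rewrite inE; exists z.
Qed.

Lemma exists_other_neighbour (a : C) u x : 1 < h -> exists2 z, E a u z & z != x.
Proof.
move=> h1; have : 0 < #|[set z | E a u z] :\ x|.
  by rewrite -ltnS; apply: leq_trans (leq_trans h1 (Edeg a u)) _; rewrite (cardsD1 x); case: (_ \in _).
by case/card_gt0P => z; rewrite !inE => /andP[zx Ez]; exists z.
Qed.

Lemma side_path (v : nat -> V) (c : nat -> C) M k :
  (forall i, i.+1 < M -> E (c i) (v i) (v i.+1)) -> k < M -> side (v k) = side (v 0) (+) odd k.
Proof.
move=> H; elim: k => [|k IH] kM; first by rewrite addbF.
by rewrite (Eside (H _ kM)) IH ?(ltnW kM) //=; case: side; case: odd.
Qed.

Hypothesis noham : ~ rainbow_hamiltonian.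

Lemma h_le_n : h <= n.
Proof.
have /card_gt0P[u _] : 0 < #|V| by rewrite cardV double_gt0.
have /card_gt0P[d _] : 0 < #|C| by nat_lia.
rewrite -(card_side (~~ side u)); apply: leq_trans (Edeg d u) _.
by apply/subset_leq_card/subsetP => z; rewrite !inE => /Eside ->.
Qed.

(** * Paths that miss two vertices and two colours *)

Section TwoGaps.
Variable m : nat.
Hypothesis nE : n = m.+1.
Hypothesis h_gt1 : 1 < h.

(* A rainbow path [v] on all vertices but [x] and [y] that leaves the colours [a] and [b] unused. *)
Definition gap2_path v c a b x y :=
  [/\ (forall k, k.+1 < m.*2 -> E (c k) (v k) (v k.+1)),
      uniq (x :: y :: seg v 0 m.*2), uniq (a :: b :: seg c 0 m.*2.-1),
      side x = side (v 0) & side y = ~~ side (v 0)].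

Lemma gap2_sym v c a b x y : gap2_path v c a b x y -> gap2_path v c b a x y.
Proof.
case=> H1 H2 H3 H4 H5; split => //; rewrite (perm_uniq (_ : perm_eq _ (a :: b :: seg c 0 m.*2.-1))) //.
by apply/permP => p /=; nat_lia.
Qed.

(** Together with [x], [y], [a] and [b] all [n.*2] vertices and all colours are used, so such a walk
    is a rainbow Hamiltonian path. The hypotheses are counts because segments get recombined in any
    order and direction. *)
Lemma gap2_no_walk v c a b x y u w A U : gap2_path v c a b x y -> walk u w A U ->
  (forall p : pred V, count p A = p x + p y + count p (seg v 0 m.*2)) ->
  (forall p : pred C, count p U = p a + p b + count p (seg c 0 m.*2.-1)) -> False.
Proof.
case=> H1 H2 H3 H4 H5 W HA HU; apply: noham; exists u, w, A, U.
have pA : perm_eq A (x :: y :: seg v 0 m.*2) by apply/permP => p /=; rewrite HA; nat_lia.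
have pU : perm_eq U (a :: b :: seg c 0 m.*2.-1) by apply/permP => p /=; rewrite HU; nat_lia.
split=> //; first by rewrite (perm_uniq pA).
  by rewrite (perm_uniq pU).
by rewrite (perm_size pA) /= size_seg; nat_lia.
Qed.

Lemma gap2_mem v c a b x y z : gap2_path v c a b x y ->
  [\/ z = x, z = y | exists2 k, k < m.*2 & z = v k].
Proof.
case=> H1 H2 H3 H4 H5; have : z \in x :: y :: seg v 0 m.*2.
  by apply: mem_full => //=; rewrite size_seg; nat_lia.
rewrite !inE; case/or3P => [/eqP->|/eqP->|/segP[k kM ->]]; [by constructor 1|by constructor 2|].
by constructor 3; exists k.
Qed.

Lemma gap2_neighbour v c a b x y d u z : gap2_path v c a b x y -> side u = side (v 0) -> E d u z ->
  z = y \/ exists2 k, k < m & z = v k.*2.+1.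
Proof.
move=> L su Ez; have [H1 H2 H3 H4 H5] := L; have sz := Eside Ez.
case: (gap2_mem z L) => [zx||[k kM zk]]; first by move: sz; rewrite zx H4 su; case: side.
  by left.
right; move: sz; rewrite zk (side_path H1 kM) su => ok.
have {}ok : odd k by move: ok; case: side; case: odd.
by exists k./2; [nat_lia|congr v; nat_lia].
Qed.

Lemma gap2_neighbour' v c a b x y d u z : gap2_path v c a b x y -> side u = ~~ side (v 0) -> E d u z ->
  z = x \/ exists2 k, k < m & z = v k.*2.
Proof.
move=> L su Ez; have [H1 H2 H3 H4 H5] := L; have sz := Eside Ez.
case: (gap2_mem z L) => [|zy|[k kM zk]]; first by left.
  by move: sz; rewrite zy H5 su; case: side.
right; move: sz; rewrite zk (side_path H1 kM) su => ok.
have {}ok : ~~ odd k by move: ok; case: side; case: odd.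
by exists k./2; [nat_lia|congr v; nat_lia].
Qed.

(* Counts the rotations of the end [v m.*2.-1] that reuse the colour of the edge they remove, hence spend no new colour. *)
Definition rotations v c := count (fun k => E (c k.*2) (v k.*2) (v m.*2.-1)) (iota 0 m).

Lemma gap2_seg v c a b x y i j : gap2_path v c a b x y -> i < j -> j <= m.*2 ->
  walk (v i) (v j.-1) (seg v i j) (seg c i j.-1).
Proof. by case=> H1 _ _ _ _ ij jM; apply: walk_seg_pred => // k *; apply: H1; nat_lia. Qed.

(** Put [y] before [v 0] in colour [a]. If [b] joins [x] to [y], put [x] in front. Otherwise [x] has
    at least [h] neighbours [v k.*2.+1] in colour [b], and since [h + h > m] one of them becomes the
    last vertex after a free rotation, where [x] is attached. *)
Lemma rotations_start_nonadjacent v c a b x y : gap2_path v c a b x y -> h <= rotations v c -> E a y (v 0) -> False.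
Proof.
move=> L hr Ey; have m0 : 0 < m by have := h_le_n; nat_lia.
have hq : h <= count (fun k => E b x (v k.*2.+1)) (iota 0 m).
  apply: (@count_neighbours b x (fun k => v k.*2.+1)) => z Ez; have [H1 H2 H3 H4 H5] := L.
  case: (gap2_neighbour L H4 Ez) => [zy|[k km zk]]; last by exists k; rewrite -zk.
  case: (@gap2_no_walk _ _ _ _ _ _ x (v m.*2.-1) ([:: x] ++ [:: y] ++ seg v 0 m.*2) ([::] ++ b :: [::] ++ a :: seg c 0 m.*2.-1) L).
  - apply: walk_cat (walk_one _ _) _ (walk_cat (walk_one _ _) Ey _); first by rewrite -zy.
    by apply: gap2_seg L _ _; nat_lia.
  - by move=> p /=; nat_lia.
  - by move=> p /=; nat_lia.
have [|k [km Pk Qk]] := @count_overlap _ _ (iota 0 m) h h _ hr hq; first by rewrite size_iota; nat_lia.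
rewrite mem_iota add0n in km.
have i1 : 0 < k.*2.+1 by [].
have i2 : k.*2.+1 < m.*2 by nat_lia.
have W1 := gap2_seg L i1 (ltnW i2).
have W2 := walk_rev Esym (gap2_seg L i2 (leqnn _)).
rewrite Esym in Qk.
apply: (gap2_no_walk L (walk_cat (walk_one E y) Ey (walk_cat W1 Pk (walk_cat W2 Qk (walk_one _ x))))).
- by move=> p; rewrite /= !countE (@count_seg_split _ p v k.*2.+1 0 m.*2) /=; nat_lia.
- by move=> p; rewrite /= !countE (@count_seg_split _ p c k.*2 0 m.*2.-1) ?(@count_seg_cons _ p c k.*2) /=; nat_lia.
Qed.

(* Cutting [v] at the edges [i] and [j] and reconnecting turns the open path into one joining [v j] to [v j.+1] with the same colours. *)
Lemma two_opt v c a b x y i j : gap2_path v c a b x y -> i != j -> i.+1 < m.*2 -> j.+1 < m.*2 ->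
  E (c i) (v i) (v m.*2.-1) -> E (c j) (v 0) (v i.+1) ->
  exists A U, [/\ walk (v j) (v j.+1) A U,
    forall p : pred V, count p A = count p (seg v 0 m.*2) &
    forall p : pred C, count p U = count p (seg c 0 m.*2.-1)].
Proof.
move=> L ij iM jM Ei Ej.
have [{}ij|ji|] := ltngtP i j; last by move/eqP: ij.
- have W1 := walk_rev Esym (@gap2_seg _ _ _ _ _ _ i.+1 j.+1 L ltac:(nat_lia) (ltnW jM)).
  have W2 := @gap2_seg _ _ _ _ _ _ 0 i.+1 L ltac:(nat_lia) (ltnW iM).
  have W3 := walk_rev Esym (@gap2_seg _ _ _ _ _ _ j.+1 m.*2 L ltac:(nat_lia) (leqnn _)).
  rewrite Esym in Ej.
  do 2 eexists; split; first exact: walk_cat W1 Ej (walk_cat W2 Ei W3).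
    move=> p; rewrite !countE (@count_seg_split _ p v i.+1 0 m.*2) ?(@count_seg_split _ p v j.+1 i.+1 m.*2); nat_lia.
  move=> p; rewrite !countE (@count_seg_split _ p c i 0 m.*2.-1) ?(@count_seg_cons _ p c i m.*2.-1); try nat_lia.
  rewrite (@count_seg_split _ p c j i.+1 m.*2.-1) ?(@count_seg_cons _ p c j m.*2.-1) /=; nat_lia.
- have W1 := walk_rev Esym (@gap2_seg _ _ _ _ _ _ 0 j.+1 L ltac:(nat_lia) (ltnW jM)).
  have W2 := @gap2_seg _ _ _ _ _ _ i.+1 m.*2 L ltac:(nat_lia) (leqnn _).
  have W3 := walk_rev Esym (@gap2_seg _ _ _ _ _ _ j.+1 i.+1 L ltac:(nat_lia) (ltnW iM)).
  rewrite Esym in Ei.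
  do 2 eexists; split; first exact: walk_cat W1 Ej (walk_cat W2 Ei W3).
    move=> p; rewrite !countE (@count_seg_split _ p v j.+1 0 m.*2) ?(@count_seg_split _ p v i.+1 j.+1 m.*2); nat_lia.
  move=> p; rewrite !countE (@count_seg_split _ p c j 0 m.*2.-1) ?(@count_seg_cons _ p c j m.*2.-1); try nat_lia.
  rewrite (@count_seg_split _ p c i j.+1 m.*2.-1) ?(@count_seg_cons _ p c i m.*2.-1) /=; nat_lia.
Qed.

(** The edge from [v l.*2.+1] to [v l.*2.+2] is opened, with [x] and [y] attached to its ends. If
    its colour joins [y] to [v 0], then [y] links [v l.*2.+2] to [v 0]. Otherwise the neighbours of
    [v 0] in that colour meet the free rotations, and [two_opt] applies. *)
Lemma rotations_no_crossing v c a b x y l : gap2_path v c a b x y -> h <= rotations v c -> l.+1 < m ->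
  E a x (v l.*2.+1) -> E b y (v l.*2.+2) -> False.
Proof.
move=> L hr lm Ex Ey; have jM : l.*2.+2 < m.*2 by nat_lia.
case Ec : (E (c l.*2.+1) y (v 0)).
- have W1 := walk_rev Esym (@gap2_seg _ _ _ _ _ _ l.*2.+2 m.*2 L jM (leqnn _)).
  have W2 := @gap2_seg _ _ _ _ _ _ 0 l.*2.+2 L isT (ltnW jM).
  rewrite Esym in Ey; rewrite Esym in Ex.
  apply: (gap2_no_walk L (walk_cat W1 Ey (walk_cat (walk_one E y) Ec (walk_rcons W2 Ex)))).
    by move=> p; rewrite -!cats1 !countE (@count_seg_split _ p v l.*2.+2 0 m.*2) /=; nat_lia.
  move=> p; rewrite -!cats1 !countE (@count_seg_split _ p c l.*2.+1 0 m.*2.-1); try nat_lia.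
  by rewrite (@count_seg_cons _ p c l.*2.+1) /=; nat_lia.
- have hq : h <= count (fun k => E (c l.*2.+1) (v 0) (v k.*2.+1)) (iota 0 m).
    apply: (@count_neighbours (c l.*2.+1) (v 0) (fun k => v k.*2.+1)) => z Ez.
    case: (gap2_neighbour L erefl Ez) => [zy|[k km zk]]; last by exists k; rewrite -zk.
    by move: Ez; rewrite zy Esym Ec.
  have [|k [km Pk Qk]] := @count_overlap _ _ (iota 0 m) h h _ hr hq; first by rewrite size_iota; nat_lia.
  rewrite mem_iota add0n in km.
  have [||A [U [W HA HU]]] := two_opt L _ _ jM Pk Qk; try nat_lia.
  rewrite Esym in Ey; apply: (gap2_no_walk L (walk_step Ex (walk_rcons W Ey))).
    by move=> p; rewrite -!cats1 !countE HA /=; nat_lia.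
  by move=> p; rewrite -!cats1 !countE HU /=; nat_lia.
Qed.

(** Compares the [a]-neighbours of [x] with the [b]-neighbours of [y] one step further along the
    path; a coincidence is what [rotations_no_crossing] excludes. That [v 0] is no [b]-neighbour of
    [y] is [rotations_start_nonadjacent] with the colours exchanged. *)
Lemma few_rotations_nonadjacent v c a b x y : gap2_path v c a b x y -> h <= rotations v c -> ~~ E a x y -> False.
Proof.
move=> L hr Exy; have m0 : 0 < m by have := h_le_n; nat_lia.
have [H1 H2 H3 H4 H5] := L.
(* At the index [m.-1] the vertex [v k.*2.+2] would be beyond the path, so this index stands for [x]
   as a neighbour of [y]. Thus [m] indices suffice and two counts of [h] overlap. The first clause
   of [p] rules this index out when [b] joins [x] to [y]. *)
pose g k := if k < m.-1 then v k.*2.+2 else x.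
pose p k := ((k < m.-1) || ~~ E b x y) && E a x (v k.*2.+1).
have hp : h <= count p (iota 0 m).
  apply: (@count_neighbours a x (fun k => v k.*2.+1)) => z Ez.
  case: (gap2_neighbour L H4 Ez) => [zy|[k km zk]]; first by rewrite -zy Ez in Exy.
  exists k; split => //; rewrite /p -zk Ez andbT.
  case: ltnP => //= mk; apply/negP => Eb.
  have ek : k.*2.+1 = m.*2.-1 by nat_lia.
  rewrite ek in zk; rewrite Esym in Eb; rewrite zk in Ez.
  have W := walk_rev Esym (@gap2_seg _ _ _ _ _ _ 0 m.*2 L ltac:(nat_lia) (leqnn _)).
  apply: (gap2_no_walk L (walk_step Eb (walk_step Ez W))) => q; rewrite !countE /=; nat_lia.
have hq : h <= count (fun k => E b y (g k)) (iota 0 m).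
  apply: (@count_neighbours b y g) => z Ez.
  case: (gap2_neighbour' L H5 Ez) => [zx|[k km zk]].
    by exists m.-1; rewrite /g ltnn -zx Ez; split => //; nat_lia.
  case: k km zk => [|k] km zk; last first.
    by exists k; rewrite /g ltn_predRL km -zk; split => //; nat_lia.
  by case: (rotations_start_nonadjacent (gap2_sym L) hr); rewrite -[v 0]zk.
have [|k [km /andP[Pk Pk'] Qk]] := @count_overlap _ _ (iota 0 m) h h _ hp hq; first by rewrite size_iota; nat_lia.
rewrite mem_iota add0n in km; move: Pk Qk; rewrite /g; case: ltnP => /= [km' _ Ey|_ Exb];
  last by rewrite Esym (negbTE Exb).
by apply: (rotations_no_crossing L hr _ Pk' Ey); nat_lia.
Qed.

(** Prolongs the path by [x] and then [y], using [a] between them: [b] joins [x] to some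
    [v l.*2.+1], which is the last vertex already or is made an end by [two_opt]. *)
Lemma few_rotations_adjacent v c a b x y : gap2_path v c a b x y -> h < rotations v c -> E a x y -> False.
Proof.
move=> L hr Exy; have m0 : 0 < m by have := h_le_n; nat_lia.
have [H1 H2 H3 H4 H5] := L.
have [z Ez zy] := exists_other_neighbour b x y h_gt1.
case: (gap2_neighbour L H4 Ez) => [/eqP|[l lm zl]]; first by rewrite (negbTE zy).
rewrite Esym in Exy; rewrite {}zl in Ez; case: (eqVneq l m.-1) => [lE|ne].
  have el : l.*2.+1 = m.*2.-1 by nat_lia.
  rewrite el in Ez.
  have W := walk_rev Esym (@gap2_seg _ _ _ _ _ _ 0 m.*2 L ltac:(nat_lia) (leqnn _)).
  by apply: (gap2_no_walk L (walk_step Exy (walk_step Ez W))) => q; rewrite !countE /=; nat_lia.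
(* The extra index [m] stands for [y] as a neighbour of [v 0]; the strict bound on the rotations
   pays for it, since [h.+1 + h > m.+1]. *)
pose g k := if k < m then v k.*2.+1 else y.
pose p k := (k < m) && E (c k.*2) (v k.*2) (v m.*2.-1).
have hp : h.+1 <= count p (iota 0 m.+1).
  apply: leq_trans hr _; rewrite -addn1 iotaD count_cat /= /p ltnn /= !addn0.
  by apply/eq_leq/eq_in_count => k; rewrite mem_iota /= => ->.
have hq : h <= count (fun k => E (c l.*2.+1) (v 0) (g k)) (iota 0 m.+1).
  apply: (@count_neighbours (c l.*2.+1) (v 0) g) => w Ew.
  case: (gap2_neighbour L erefl Ew) => [wy|[k km wk]].
    by exists m; rewrite /g ltnn -wy.
  by exists k; rewrite /g km -wk; split => //; nat_lia.
have [|k [_ /andP[km Pk] Qk]] := @count_overlap _ _ (iota 0 m.+1) h.+1 h _ hp hq; first by rewrite size_iota; nat_lia.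
rewrite /g km in Qk.
have [|||A [U [W HA HU]]] := two_opt L _ _ _ Pk Qk; try nat_lia.
by apply: (gap2_no_walk L (walk_step Exy (walk_step Ez W))) => q; rewrite !countE ?HA ?HU /=; nat_lia.
Qed.

End TwoGaps.

(** * Rainbow cycles *)

Section Cycles.
Variable m : nat.

(* [w] and [c] are periodic, which makes every rotation of the cycle a shift of indices; for [m = 1] this is one edge with two colours. *)
Definition rainbow_cycle (w : nat -> V) c :=
  [/\ forall k, E (c k) (w k) (w k.+1), forall k, w (k + m.*2) = w k,
      forall k, c (k + m.*2) = c k, uniq (seg w 0 m.*2) & uniq (seg c 0 m.*2)].

Lemma side_rainbow_cycle (w : nat -> V) c k : rainbow_cycle w c -> side (w k) = side (w 0) (+) odd k.
Proof. by case=> H1 _ _ _ _; apply: (@side_path w c k.+1) => // *; apply: H1. Qed.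

Lemma rainbow_cycle_card_side_le (b : bool) (w : nat -> V) c : rainbow_cycle w c ->
  #|[set z in seg w 0 m.*2 | side z == b]| <= m.
Proof.
(* [e] is the parity of the indices at which the cycle visits side [b]. *)
move=> Hc; pose e := side (w 0) (+) b.
rewrite -[X in _ <= X](size_iota 0) -(size_map (fun k => w (k.*2 + e))).
apply: leq_trans (card_size _); apply/subset_leq_card/subsetP => x.
rewrite inE => /andP[/segP[k kM xk] /eqP sx].
rewrite xk; apply/mapP; exists k./2; first by rewrite mem_iota; nat_lia.
move: sx; rewrite xk (side_rainbow_cycle k Hc) /e => <-; case: (side (w 0)); case ok : (odd k) => /=; congr w; nat_lia.
Qed.

Lemma rainbow_cycle_outside (b : bool) (w : nat -> V) c : m < n -> rainbow_cycle w c ->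
  exists2 x, side x = b & x \notin seg w 0 m.*2.
Proof.
move=> mn Hc; have : ~~ ([set z | side z == b] \subset [set z in seg w 0 m.*2 | side z == b]).
  by apply/negP => /subset_leq_card; rewrite card_side leqNgt (leq_ltn_trans (rainbow_cycle_card_side_le b Hc)).
case/subsetPn => x; rewrite !inE => /eqP sx; rewrite sx eqxx andbT => xw.
by exists x.
Qed.

End Cycles.

(** * A rainbow cycle that misses two vertices *)

Section LongCycle.
Variable m : nat.
Hypothesis nE : n = m.+1.
Hypothesis h_gt1 : 1 < h.
Variables (w : nat -> V) (c : nat -> C) (a : C) (x y : V).
Hypothesis Hcyc : rainbow_cycle m w c.
Hypothesis aN : a \notin seg c 0 m.*2.
Hypotheses (xN : x \notin seg w 0 m.*2) (yN : y \notin seg w 0 m.*2).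
Hypotheses (sx : side x = side (w 0)) (sy : side y = ~~ side (w 0)).

Lemma m_gt0 : 0 < m. Proof. by have := h_le_n; nat_lia. Qed.

Lemma shift_uniq r x' y' : x' != y' -> x' \notin seg w 0 m.*2 -> y' \notin seg w 0 m.*2 ->
  uniq (x' :: y' :: seg (fun k => w (k + r)) 0 m.*2) /\
  uniq (a :: c (m.*2.-1 + r) :: seg (fun k => c (k + r)) 0 m.*2.-1).
Proof.
move=> xy xN' yN'; have [H1 H2 H3 H4 H5] := Hcyc; have m0 := m_gt0; split.
  have P : perm_eq (x' :: y' :: seg (fun k => w (k + r)) 0 m.*2) (x' :: y' :: seg w 0 m.*2).
    by rewrite !perm_cons seg_shift add0n [_ + r]addnC perm_seg_period.
  by rewrite (perm_uniq P) /= inE (negbTE xy) xN' yN' H4.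
have P : perm_eq (a :: c (m.*2.-1 + r) :: seg (fun k => c (k + r)) 0 m.*2.-1) (a :: seg c 0 m.*2).
  have P := perm_seg_period r H3; rewrite addnC -[X in seg c X _]add0n -seg_shift in P.
  rewrite -(permPr (_ : perm_eq (a :: seg (fun k => c (k + r)) 0 m.*2) _)) ?perm_cons //.
  by apply/permP => p; rewrite (@count_seg_split _ p _ m.*2.-1 0 m.*2)
    ?(@count_seg_cons _ p _ m.*2.-1) ?(@seg_nil _ _ m.*2.-1.+1) ?countE //=; nat_lia.
by rewrite (perm_uniq P) /= aN H5.
Qed.

Lemma xy_neq : x != y.
Proof. by apply/eqP => e; move: sy; rewrite -e sx; case: side. Qed.

Lemma gap2_shift_even q : gap2_path m (fun k => w (k + q.*2)) (fun k => c (k + q.*2)) a (c (m.*2.-1 + q.*2)) x y.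
Proof.
have [U1 U2] := shift_uniq q.*2 xy_neq xN yN; have [H1 _ _ _ _] := Hcyc.
split=> [k _||||]; [exact: H1|exact: U1|exact: U2| |];
  by rewrite /= add0n (side_rainbow_cycle _ Hcyc) ?sx ?sy odd_double addbF.
Qed.

(** After an odd shift the path starts on the side of [y], so [x] and [y] exchange roles. The opened
    edge is the one from [w k.*2] to [w k.*2.+1]. *)
Lemma gap2_shift_odd k : gap2_path m (fun i => w (i + k.*2.+1)) (fun i => c (i + k.*2.+1)) a (c k.*2) y x.
Proof.
have [U1 U2] := shift_uniq k.*2.+1 (etrans (congr1 negb (eq_sym y x)) xy_neq) yN xN.
have [H1 _ H3 _ _] := Hcyc; have m0 := m_gt0.
have e : c (m.*2.-1 + k.*2.+1) = c k.*2 by rewrite -(H3 k.*2); congr c; nat_lia.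
rewrite e in U2.
split=> [i _||||]; [exact: H1|exact: U1|exact: U2| |];
  by rewrite /= add0n (side_rainbow_cycle _ Hcyc) ?sx ?sy /= odd_double ?addbT ?negbK.
Qed.

(* Summing over [z] counts each [w k.*2] with its degree in the colour of the next edge, so some [z] has at least average indegree. *)
Definition indegree z := count (fun k => E (c k.*2) (w k.*2) z) (iota 0 m).

(** Wherever the cycle is opened, the index runs over a full period of the even positions, so only
    the last vertex matters. *)
Lemma rotations_indegree q :
  rotations m (fun k => w (k + q.*2)) (fun k => c (k + q.*2)) = indegree (w (m.*2.-1 + q.*2)).
Proof.
have [H1 H2 H3 _ _] := Hcyc; rewrite /rotations /indegree; set z := w (_ + _).
pose f k := E (c k.*2) (w k.*2) z.
have fp k : f (k + m) = f k by rewrite /f doubleD H2 H3.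
have := permP (perm_seg_period q fp) id; rewrite addnC -[X in seg f X _]add0n -seg_shift !segE /index_iota !subn0 !count_map => H.
 rewrite -[RHS]/(count f _) -[RHS]H; apply: eq_count => k /=.
by rewrite /f doubleD.
Qed.

Lemma outsider_or_odd z : side z = ~~ side (w 0) -> z != y ->
  exists2 l, l < m & z = w l.*2.+1.
Proof.
move=> sz zy; have L := gap2_shift_even 0; have [H1 _ _ _ _] := Hcyc.
have := gap2_mem nE h_gt1 z L; rewrite /= => -[zx|/eqP|[k kM]]; first by move: sz; rewrite zx sx; case: side.
  by rewrite (negbTE zy).
rewrite addn0 => zk; move: sz; rewrite zk (side_rainbow_cycle _ Hcyc) => ok.
have {}ok : odd k by move: ok; case: side; case: odd.
by exists k./2; [nat_lia|congr w; nat_lia].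
Qed.

Lemma sum_indegree : m * h <= \sum_(z | side z == ~~ side (w 0)) indegree z.
Proof.
have -> : \sum_(z | side z == ~~ side (w 0)) indegree z =
    \sum_(k <- iota 0 m) #|[set z | E (c k.*2) (w k.*2) z]|.
  transitivity (\sum_(z | side z == ~~ side (w 0)) \sum_(k <- iota 0 m) (E (c k.*2) (w k.*2) z : nat)).
    by apply: eq_bigr => z _; rewrite /indegree -sum1_count big_mkcond; apply: eq_bigr => k _; case: (E _ _ _).
  rewrite exchange_big; apply: eq_bigr => k _ /=.
  rewrite -sum1dep_card [RHS]big_mkcond [LHS]big_mkcond; apply: eq_bigr => z _.
  case Ez : (E _ _ _); last by case: ifP.
  by rewrite (Eside Ez) (side_rainbow_cycle _ Hcyc) odd_double addbF eqxx.
rewrite -[X in X * _](size_iota 0) -sum1_size big_distrl /=.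
by apply: leq_sum => k _; rewrite mul1n Edeg.
Qed.

(** Each of the [m] vertices other than [y] on the side of [y] can be made the last vertex of the
    opened cycle, so its indegree is at most [h], and at most [h.-1] if [a] does not join [x] to
    [y]. In both cases a further loss brings the sum below [m * h], against [sum_indegree]. *)
Lemma long_cycle_false : False.
Proof.
have m0 := m_gt0; have [H1 H2 H3 _ _] := Hcyc.
have low z : side z = ~~ side (w 0) -> z != y -> indegree z <= h - ~~ E a x y.
  move=> sz zy; have [l lm zl] := outsider_or_odd sz zy.
  have L := gap2_shift_even l.+1; have := rotations_indegree l.+1.
  have -> : w (m.*2.-1 + l.+1.*2) = z by rewrite zl -(H2 l.*2.+1); congr w; nat_lia.
  move=> <-; case Exy : (E a x y).
    by rewrite subn0 leqNgt; apply/negP => hr; exact: (few_rotations_adjacent nE h_gt1 L hr Exy).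
  rewrite subn1 leqNgt; apply/negP => hr; apply: (few_rotations_nonadjacent nE h_gt1 L _ (negbT Exy)); nat_lia.
have sum := sum_indegree.
rewrite (bigD1 y) /= ?sy // in sum.
have card_rest : #|[pred z | (side z == ~~ side (w 0)) && (z != y)]| = m.
  have := card_side (~~ side (w 0)); rewrite (cardsD1 y) inE sy eqxx nE add1n => -[<-].
  by apply: eq_card => z; rewrite !inE andbC.
case Exy : (E a x y) low => low.
(* If [c k.*2] joined [w k.*2] to [y], the cycle opened after [w k.*2] would continue to [y] and
   then to [x] in colour [a]. *)
- have Dy : indegree y = 0.
    apply/eqP; rewrite -leqn0 leqNgt -has_count; apply/hasPn => k _; apply/negP => Ey.
    have L := gap2_shift_odd k; have W := @gap2_seg _ nE h_gt1 _ _ _ _ _ _ 0 m.*2 L ltac:(nat_lia) (leqnn _).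
    have ey : E (c k.*2) (w (m.*2.-1 + k.*2.+1)) y.
      by have -> : w (m.*2.-1 + k.*2.+1) = w k.*2 by rewrite -(H2 k.*2); congr w; nat_lia.
    rewrite Esym in Exy.
    by apply: (gap2_no_walk nE h_gt1 L (walk_rcons (walk_rcons W ey) Exy)) => p; rewrite -!cats1 !countE /=; nat_lia.
  have [z Ez zx] := exists_other_neighbour a y x h_gt1.
  have L := gap2_shift_even 0.
  have [/eqP|[k km zk]] := gap2_neighbour' nE h_gt1 L sy Ez; first by rewrite (negbTE zx).
  rewrite addn0 in zk.
  (* The [a]-neighbour [w k.*2] of [y] is taken as the start of the path; by
     [rotations_start_nonadjacent] the vertex before it on the cycle then has indegree below [h]. *)
  have low0 : indegree (w (m.*2.-1 + k.*2)) < h.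
    rewrite ltnNge -rotations_indegree; apply/negP => hr.
    by apply: (rotations_start_nonadjacent nE h_gt1 (gap2_shift_even k) hr); rewrite -zk.
  set z0 := w _ in low0.
  have sz0 : side z0 = ~~ side (w 0).
    have om : odd m.*2.-1 by nat_lia.
    by rewrite /z0 (side_rainbow_cycle (m.*2.-1 + k.*2) Hcyc) oddD odd_double om addbT.
  have z0y : z0 != y.
    apply/eqP => e; case/negP: yN; rewrite -e /z0 -(perm_mem (perm_seg_period k.*2 H2)).
    by apply: mem_seg; nat_lia.
  rewrite (bigD1 z0) /= ?sz0 ?eqxx // Dy in sum.
  have rest : \sum_(i | (side i == ~~ side (w 0)) && (i != y) && (i != z0)) indegree i <= m.-1 * h.
    rewrite -card_rest (cardD1 z0) !inE sz0 eqxx z0y /= -sum_nat_const.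
    rewrite [X in _ <= X](eq_bigl (fun i => (side i == ~~ side (w 0)) && (i != y) && (i != z0))); last first.
      by move=> i; rewrite !inE andbC.
    by apply: leq_sum => i /andP[/andP[/eqP si iy] _]; apply: leq_trans (low i si iy) _; rewrite subn0.
  by case: m m0 sum rest => // m' _ /=; rewrite mulSn; nat_lia.
(* Some [w k.*2.+1] is an [a]-neighbour of [x]. Opening the cycle just before it and attaching [x]
   there shows that the index [k] does not count for [y]. *)
- have Dy : indegree y < m.
    have [z Ez zy] := exists_other_neighbour a x y h_gt1.
    have [k km zk] := outsider_or_odd (etrans (Eside Ez) (congr1 negb sx)) zy.
    rewrite /indegree -[X in _ < X](size_iota 0) -(count_predC (fun k => E (c k.*2) (w k.*2) y)) -addn1 leq_add2l -has_count.
    apply/hasP; exists k; rewrite ?mem_iota //=; apply/negP => Ey.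
    have L := gap2_shift_odd k; have W := @gap2_seg _ nE h_gt1 _ _ _ _ _ _ 0 m.*2 L ltac:(nat_lia) (leqnn _).
    have ey : E (c k.*2) (w (m.*2.-1 + k.*2.+1)) y.
      by have -> : w (m.*2.-1 + k.*2.+1) = w k.*2 by rewrite -(H2 k.*2); congr w; nat_lia.
    rewrite zk in Ez.
    by apply: (gap2_no_walk nE h_gt1 L (walk_step Ez (walk_rcons W ey))) => p; rewrite -!cats1 !countE /=; nat_lia.
  have rest : \sum_(i | (side i == ~~ side (w 0)) && (i != y)) indegree i <= m * h.-1.
    rewrite -card_rest -sum_nat_const.
    by apply: leq_sum => i /andP[/eqP si iy]; apply: leq_trans (low i si iy) _; rewrite subn1.
  by case: h h_gt1 sum rest => // h' _ /=; rewrite mulnS; nat_lia.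
Qed.
End LongCycle.

(** Indices are read modulo [m.*2]; the last index of a period carries the closing colour [d]. *)
Lemma closed_walk_rainbow_cycle m u w A U d : walk u w A U -> E d w u -> uniq A -> uniq (d :: U) ->
  size A = m.*2 -> exists (w' : nat -> V) c, rainbow_cycle m w' c.
Proof.
move=> W Ed uA uU sA; have sU := walk_size W.
have [v [c [HA HU Hu Hw He]]] := walkE d W.
have m0 : 0 < m.*2 by nat_lia.
exists (fun k => v (k %% m.*2)), (fun k => if k %% m.*2 == m.*2.-1 then d else c (k %% m.*2)).
split=> [k|k|k||].
- rewrite modnS; have kM := ltn_pmod k m0; case: eqVneq => ke.
    have -> : m.*2 %| k.+1.
      by rewrite /dvdn -addn1 -modnDml ke addn1 prednK // modnn.
    rewrite ke -Hu; have -> : m.*2.-1 = size U by nat_lia.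
    by rewrite -Hw.
  have -> : (m.*2 %| k.+1) = false.
    by rewrite /dvdn -addn1 -modnDml modn_small; nat_lia.
  by apply: He; nat_lia.
- by rewrite modnDr.
- by rewrite modnDr.
- rewrite (@eq_seg _ _ v) => [|k kM]; last by rewrite modn_small.
  by rewrite -sA sU -HA.
have e : perm_eq (d :: U) (seg (fun k => if k %% m.*2 == m.*2.-1 then d else c (k %% m.*2)) 0 m.*2).
  rewrite (@seg_split _ _ m.*2.-1) ?leq_pred // perm_sym perm_catC.
  rewrite (@seg_cons _ _ m.*2.-1) ?(@seg_nil _ _ m.*2.-1.+1); try nat_lia.
  rewrite modn_small ?eqxx; last by nat_lia.
  rewrite (@eq_seg _ _ c) => [|k kM]; last first.
    by rewrite modn_small; [case: eqP => //; nat_lia | nat_lia].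
  have sM : size U = m.*2.-1 by nat_lia.
  by rewrite -sM -HU.
by rewrite -(perm_uniq e).
Qed.

Lemma uncoloured U : size U < #|C| -> exists a, a \notin U.
Proof.
move=> sU; have : ~~ (C \subset U).
  by apply/negP => /subset_leq_card H; have := leq_trans H (card_size U); rewrite leqNgt sU.
by case/subsetPn => a _ aU; exists a.
Qed.

Lemma long_rainbow_cycle_false m (w : nat -> V) c : n = m.+1 -> 1 < h -> rainbow_cycle m w c -> False.
Proof.
move=> nE h1 Hc; have mn : m < n by rewrite nE.
have [x sx xN] := rainbow_cycle_outside (side (w 0)) mn Hc.
have [y sy yN] := rainbow_cycle_outside (~~ side (w 0)) mn Hc.
have [|a aN] := @uncoloured (seg c 0 m.*2); first by rewrite size_seg; nat_lia.
exact: (long_cycle_false nE h1 Hc aN xN yN sx sy).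
Qed.

(** Sides alternate, so at most [r] of the first [M] vertices lie opposite to [v 0]. *)
Lemma path_outside v c r M : r < n -> M <= r.*2.+1 ->
  (forall i, i.+1 < M -> E (c i) (v i) (v i.+1)) ->
  exists2 y, side y = ~~ side (v 0) & y \notin seg v 0 M.
Proof.
move=> rn Mr He; have : ~~ ([set z | side z == ~~ side (v 0)] \subset [seq v k.*2.+1 | k <- iota 0 r]).
  apply/negP => /subset_leq_card; rewrite card_side => H.
  by have := leq_trans H (card_size _); rewrite size_map size_iota leqNgt rn.
case/subsetPn => x; rewrite inE => /eqP sx xw; exists x => //; apply/negP => /segP[k kM xk].
move: sx; rewrite xk (side_path He) ?(andP kM) // => ok.
have {}ok : odd k by move: ok; case: side; case: odd.
case/negP: xw; rewrite xk; apply/mapP; exists k./2; first by rewrite mem_iota; nat_lia.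
congr v; nat_lia.
Qed.

(** * Paths that miss one vertex and one colour *)

Section OneGap.
Variable m : nat.
Hypothesis nE : n = m.+1.

(* A rainbow path [v] on all vertices but [y] that leaves the colour [a] unused. *)
Definition gap1_path v c a y :=
  [/\ (forall k, k < m.*2 -> E (c k) (v k) (v k.+1)),
      uniq (y :: seg v 0 m.*2.+1), uniq (a :: seg c 0 m.*2) & side y = ~~ side (v 0)].

Lemma gap1_no_walk v c a y u w A U : gap1_path v c a y -> walk u w A U ->
  (forall p : pred V, count p A = p y + count p (seg v 0 m.*2.+1)) ->
  (forall p : pred C, count p U = p a + count p (seg c 0 m.*2)) -> False.
Proof.
case=> H1 H2 H3 H4 W HA HU; apply: noham; exists u, w, A, U.
have pA : perm_eq A (y :: seg v 0 m.*2.+1) by apply/permP => p /=; rewrite HA.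
have pU : perm_eq U (a :: seg c 0 m.*2) by apply/permP => p /=; rewrite HU.
split=> //; first by rewrite (perm_uniq pA).
  by rewrite (perm_uniq pU).
by rewrite (perm_size pA) /= size_seg; nat_lia.
Qed.

Lemma gap1_mem v c a y z : gap1_path v c a y -> z = y \/ exists2 k, k <= m.*2 & z = v k.
Proof.
case=> H1 H2 H3 H4; have : z \in y :: seg v 0 m.*2.+1.
  by apply: mem_full => //=; rewrite size_seg; nat_lia.
by rewrite inE => /orP[/eqP->|/segP[k kM ->]]; [left|right; exists k].
Qed.

Lemma gap1_side v c a y k : gap1_path v c a y -> k <= m.*2 -> side (v k) = side (v 0) (+) odd k.
Proof. by case=> H1 _ _ _ kM; apply: (@side_path v c m.*2.+1) => // i iM; apply: H1; nat_lia. Qed.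

Lemma gap1_neighbour v c a y d u z : gap1_path v c a y -> side u = side (v 0) -> E d u z ->
  z = y \/ exists2 k, k < m & z = v k.*2.+1.
Proof.
move=> L su Ez; have sz := Eside Ez.
case: (gap1_mem z L) => [|[k kM zk]]; first by left.
right; move: sz; rewrite zk (gap1_side L kM) su => ok.
have {}ok : odd k by move: ok; case: side; case: odd.
by exists k./2; [nat_lia|congr v; nat_lia].
Qed.

Lemma gap1_neighbour' v c a y d u z : gap1_path v c a y -> side u = ~~ side (v 0) -> E d u z ->
  exists2 k, k <= m & z = v k.*2.
Proof.
move=> L su Ez; have [H1 H2 H3 H4] := L; have sz := Eside Ez.
case: (gap1_mem z L) => [zy|[k kM zk]]; first by move: sz; rewrite zy H4 su; case: side.
move: sz; rewrite zk (gap1_side L kM) su => ok.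
have {}ok : ~~ odd k by move: ok; case: side; case: odd.
by exists k./2; [nat_lia|congr v; nat_lia].
Qed.

Lemma gap1_seg v c a y i j : gap1_path v c a y -> i < j -> j <= m.*2.+1 ->
  walk (v i) (v j.-1) (seg v i j) (seg c i j.-1).
Proof. by case=> H1 _ _ _ ij jM; apply: walk_seg_pred => // k *; apply: H1; nat_lia. Qed.

Lemma gap1_ends v c a y : gap1_path v c a y -> ~~ E a y (v 0) /\ ~~ E a y (v m.*2).
Proof.
move=> L; split; apply/negP => Ey.
  by apply: (gap1_no_walk L (walk_step Ey (gap1_seg L (ltn0Sn _) (leqnn _)))) => q;
  rewrite !countE.
apply: (gap1_no_walk L (walk_step Ey (walk_rev Esym (gap1_seg L (ltn0Sn _) (leqnn _))))) => q;
by rewrite !countE.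
Qed.

Hypothesis h_gt1 : 1 < h.

(* If the first edge is not in the unused colour, then the neighbours of [v 0] in that colour and those of [v m.*2.-1] in the last colour must cross, which closes a rainbow cycle of length [m.*2]. *)
Lemma gap1_first_edge v c a y : gap1_path v c a y -> E a (v 0) (v 1).
Proof.
move=> L; have m0 : 0 < m by have := h_le_n; nat_lia.
have [H1 H2 H3 H4] := L; apply: contraT => N1.
have cycF u w A U d : walk u w A U -> E d w u ->
   (forall z, count_mem z A <= count_mem z (y :: seg v 0 m.*2.+1)) ->
   (forall e : C, count_mem e (d :: U) <= count_mem e (a :: seg c 0 m.*2)) -> size A = m.*2 -> False.
  move=> W Ed HA HU sA.
  have uA : uniq A by apply/uniq_countP => z; apply: leq_trans (HA z) _; move: z; apply/uniq_countP.
  have uU : uniq (d :: U) by apply/uniq_countP => z; apply: leq_trans (HU z) _; move: z; apply/uniq_countP.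
  have [w' [c' Hc]] := closed_walk_rainbow_cycle W Ed uA uU sA.
  exact: long_rainbow_cycle_false nE h_gt1 Hc.
(* As [y] and [v 1] are excluded, the [a]-neighbours of [v 0] start at [v 3]. The offset pairs
   [v k.*2.+3] with its predecessor [v k.*2.+2], which is sought among the neighbours of
   [v m.*2.-1]. *)
pose p k := (k < m.-1) && E a (v 0) (v k.*2.+3).
have hp : h <= count p (iota 0 m).
  apply: (@count_neighbours a (v 0) (fun k => v k.*2.+3)) => z Ez.
  case: (gap1_neighbour L erefl Ez) => [zy|[[|k] km zk]].
  - rewrite zy Esym in Ez; case: (gap1_no_walk L (walk_step Ez (gap1_seg L (ltn0Sn _) (leqnn _)))) => q;
    by rewrite !countE.
  - by rewrite zk (negbTE N1) in Ez.
  - by exists k; rewrite /p -zk Ez; split => //; nat_lia.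
have hq : h <= count (fun k => E (c m.*2.-1) (v m.*2.-1) (v k.*2.+2)) (iota 0 m).
  apply: (@count_neighbours (c m.*2.-1) (v m.*2.-1) (fun k => v k.*2.+2)) => z Ez.
  have sv : side (v m.*2.-1) = ~~ side (v 0).
    have om : odd m.*2.-1 by nat_lia.
    by rewrite (gap1_side L (leq_pred _)) om addbT.
  have [[|k] km zk] := gap1_neighbour' L sv Ez; last by exists k; rewrite -zk.
  rewrite zk in Ez; case: (cycF _ _ _ _ _ (@gap1_seg _ _ _ _ 0 m.*2 L ltac:(nat_lia) (leqnSn _)) Ez) => [z'|z'|].
  - by rewrite countE (@count_seg_split _ _ v m.*2 0 m.*2.+1) //=; nat_lia.
  - by rewrite !countE (@count_seg_split _ _ c m.*2.-1 0 m.*2) ?(@count_seg_cons _ _ c m.*2.-1 m.*2) /=; nat_lia.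
  - by rewrite size_seg subn0.
have [|k [_ /andP[km Pk] Qk]] := @count_overlap _ _ (iota 0 m) h h _ hp hq; first by rewrite size_iota; nat_lia.
have W1 := walk_rev Esym (@gap1_seg _ _ _ _ 0 k.*2.+3 L ltac:(nat_lia) ltac:(nat_lia)).
have W2 := @gap1_seg _ _ _ _ k.*2.+3 m.*2 L ltac:(nat_lia) ltac:(nat_lia).
case: (cycF _ _ _ _ _ (walk_cat W1 Pk W2) Qk) => [z|z|].
- by rewrite !countE (@count_seg_split _ _ v k.*2.+3 0 m.*2.+1)
  ?(@count_seg_split _ _ v m.*2 k.*2.+3 m.*2.+1) /=; nat_lia.
- rewrite !countE (@count_seg_split _ _ c k.*2.+2 0 m.*2) ?(@count_seg_cons _ _ c k.*2.+2 m.*2); try nat_lia.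
  by rewrite (@count_seg_split _ _ c m.*2.-1 k.*2.+3 m.*2) ?(@count_seg_cons _ _ c m.*2.-1 m.*2) /=; nat_lia.
- by rewrite size_cat size_rev !size_seg; nat_lia.
Qed.

(** Carries [gap1_first_edge] over to recombined paths, given as a walk with its first edge split
    off. *)
Lemma first_edge z0 z1 d u A U a y : E d z0 z1 -> walk z1 u A U ->
  uniq (y :: z0 :: A) -> uniq (a :: d :: U) -> size A = m.*2 -> side y = ~~ side z0 -> E a z0 z1.
Proof.
move=> Ed W uA uU sA sy.
have [v [c [HA HU Hu Hw He]]] := walkE d (walk_step Ed W).
have sU : size (d :: U) = m.*2 by rewrite /= -(walk_size W).
rewrite sU in HA HU He.
have L : gap1_path v c a y by split=> //; rewrite -?HA -?HU -?Hu.
have := gap1_first_edge L; rewrite -Hu.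
have [A' eA] := walk_head W; move: HA; rewrite eA seg_cons // seg_cons; last by have := h_le_n; nat_lia.
by case=> _ <-.
Qed.

Lemma gap1_path_false_gt1 v c a y : gap1_path v c a y -> False.
Proof.
move=> L; have m0 : 0 < m by have := h_le_n; nat_lia.
have [H1 H2 H3 H4] := L.
have UV z := elimT (uniq_countP _) H2 z.
have UC (d : C) := elimT (uniq_countP _) H3 d.
have E1 := gap1_first_edge L.
have [yv0 yvM] := gap1_ends L.
have EM : E (c m.*2.-1) (v m.*2.-1) (v m.*2) by have := H1 m.*2.-1; rewrite prednK; [apply|]; nat_lia.
have sM : side y = ~~ side (v m.*2) by rewrite H4 (gap1_side L (leqnn _)) odd_double addbF.
have E2 : E a (v m.*2) (v m.*2.-1).
  rewrite Esym in EM.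
  apply: (first_edge (y := y) EM (walk_rev Esym (@gap1_seg _ _ _ _ 0 m.*2 L ltac:(nat_lia) (leqnSn _)))) => //.
  - apply/uniq_countP => z; apply: leq_trans (UV z).
    by rewrite !countE (@count_seg_split _ _ v m.*2 0 m.*2.+1) // (@count_seg_cons _ _ v m.*2) /=; nat_lia.
  - apply/uniq_countP => z; apply: leq_trans (UC z).
    by rewrite !countE (@count_seg_split _ _ c m.*2.-1 0 m.*2) ?(@count_seg_cons _ _ c m.*2.-1 m.*2) /=; nat_lia.
  - by rewrite size_rev size_seg subn0.
(* If [c 0] joined [v 0] to [y], the first edge could take colour [a] and leave [c 0] for attaching
   [y]. *)
have hp : h <= count (fun k => E (c 0) (v 0) (v k.*2.+1)) (iota 0 m).
  apply: (@count_neighbours (c 0) (v 0) (fun k => v k.*2.+1)) => z Ez.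
  case: (gap1_neighbour L erefl Ez) => [zy|[k km zk]]; last by exists k; rewrite -zk.
  rewrite zy Esym in Ez.
  case: (gap1_no_walk L (walk_step Ez (walk_step E1 (@gap1_seg _ _ _ _ 1 m.*2.+1 L ltac:(nat_lia) (leqnn _))))) => q.
    by rewrite !countE (@count_seg_cons _ _ v 0).
  by rewrite !countE (@count_seg_cons _ _ c 0) /=; nat_lia.
have hq : h <= count (fun k => E a y (v k.*2)) (iota 0 m).
  apply: (@count_neighbours a y (fun k => v k.*2)) => z Ez.
  have [k km zk] := gap1_neighbour' L H4 Ez; exists k; rewrite -zk; split=> //.
  by rewrite ltn_neqAle km andbT; apply: contra yvM => /eqP <-; rewrite -zk.
have [|k [km Pk Qk]] := @count_overlap _ _ (iota 0 m) h h _ hp hq; first by rewrite size_iota; nat_lia.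
rewrite mem_iota add0n in km.
have k0 : 0 < k by case: k Qk {km Pk} => // Qk; rewrite Qk in yv0.
have iM : k.*2.+2 <= m.*2 by nat_lia.
have i0 : 0 < k.*2 by nat_lia.
move: (k.*2) iM i0 Pk Qk => i iM i0 Pk Qk {k km k0}.
have W2 := walk_rev Esym (@gap1_seg _ _ _ _ i.+1 m.*2 L ltac:(nat_lia) (leqnSn _)).
have W1 := @gap1_seg _ _ _ _ 1 i.+1 L ltac:(nat_lia) ltac:(nat_lia).
have Pk' := Pk; rewrite Esym in Pk'.
have EM' := EM; rewrite Esym in EM'.
have E3 : E (c i) (v m.*2) (v m.*2.-1).
  apply: (first_edge (y := y) EM' (walk_cat W2 Pk' (walk_step E1 W1))) => //.
  - apply/uniq_countP => z; apply: leq_trans (UV z).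
    rewrite !countE (@count_seg_split _ _ v m.*2 0 m.*2.+1) // (@count_seg_cons _ _ v m.*2) //.
    by rewrite (@count_seg_cons _ _ v 0) ?(@count_seg_split _ _ v i.+1 1 m.*2) /=; nat_lia.
  - apply/uniq_countP => z; apply: leq_trans (UC z).
    rewrite !countE (@count_seg_split _ _ c m.*2.-1 0 m.*2) ?(@count_seg_cons _ _ c m.*2.-1 m.*2); try nat_lia.
    rewrite (@count_seg_cons _ _ c 0) ?(@count_seg_split _ _ c i 1 m.*2.-1)
      ?(@count_seg_cons _ _ c i m.*2.-1) /=; nat_lia.
  - by rewrite size_cat size_rev /= !size_seg; nat_lia.
have E4 : E (c m.*2.-1) (v 0) (v 1).
  have Ea := E2; rewrite Esym in Ea.
  apply: (first_edge (y := y) (H1 0 ltac:(nat_lia))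
    (walk_rcons (@gap1_seg _ _ _ _ 1 m.*2 L ltac:(nat_lia) (leqnSn _)) Ea)) => //.
  - apply/uniq_countP => z; apply: leq_trans (UV z).
    rewrite -!cats1 !countE (@count_seg_split _ _ v m.*2 0 m.*2.+1) // (@count_seg_cons _ _ v m.*2) //.
    by rewrite (@count_seg_cons _ _ v 0) /=; nat_lia.
  - apply/uniq_countP => z; apply: leq_trans (UC z).
    rewrite -!cats1 !countE (@count_seg_split _ _ c m.*2.-1 0 m.*2) ?(@count_seg_cons _ _ c m.*2.-1 m.*2); try nat_lia.
    by rewrite (@count_seg_cons _ _ c 0) /=; nat_lia.
  - by rewrite size_rcons size_seg; nat_lia.
have W3 := @gap1_seg _ _ _ _ i.+1 m.*2 L ltac:(nat_lia) (leqnSn _).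
rewrite Esym in E3; rewrite Esym in E4.
(* The Hamiltonian path is [y], [v i] down to [v 1], [v 0], then [v i.+1] up to [v m.*2]. The edges
   at [y], from [v 1] to [v 0], from [v 0] to [v i.+1] and at [v m.*2] have the colours [a],
   [c m.*2.-1], [c 0] and [c i]. *)
apply: (gap1_no_walk L (walk_step Qk (walk_cat (walk_rev Esym W1) E4 (walk_step Pk (walk_rcons W3 E3))))) => q.
- rewrite -!cats1 !countE (@count_seg_split _ _ v m.*2 0 m.*2.+1) // (@count_seg_cons _ _ v m.*2) //.
  by rewrite (@count_seg_cons _ _ v 0) ?(@count_seg_split _ _ v i.+1 1 m.*2) ?(@seg_nil _ v m.*2.+1) //=; nat_lia.
- rewrite -!cats1 !countE (@count_seg_split _ _ c m.*2.-1 0 m.*2) ?(@count_seg_cons _ _ c m.*2.-1 m.*2); try nat_lia.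
  by rewrite (@count_seg_cons _ _ c 0) ?(@count_seg_split _ _ c i 1 m.*2.-1)
    ?(@count_seg_cons _ _ c i m.*2.-1) ?(@seg_nil _ c m.*2.-1.+1) //=; nat_lia.
Qed.
End OneGap.

Lemma gap1_path_false m v c a y : n = m.+1 -> gap1_path m v c a y -> False.
Proof.
(* If [h <= 1] then [m <= 1], and an [a]-neighbour of [y] can only be an end of the path, which
   [gap1_ends] excludes. *)
move=> nE L; have [h1|h1] := ltnP 1 h; first exact: (gap1_path_false_gt1 nE h1 L).
have [_ _ _ sy] := L; have [yv0 yvM] := gap1_ends nE L.
have [z Ez] := exists_neighbour a y; have [k km zk] := gap1_neighbour' nE L sy Ez.
have [k0|k1] : k = 0 \/ k = m by nat_lia.
  by move: yv0; rewrite -[0]/(0.*2) -k0 -zk Ez.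
by move: yvM; rewrite -k1 -zk Ez.
Qed.

(** * The exceptional case and the extension of shorter paths *)

Definition two_blocks := exists S : {set V},
  [/\ n = h.*2, forall b : bool, #|[set z in S | side z == b]| = h &
      forall d u z, E d u z = (side u != side z) && ((u \in S) == (z \in S))].

Definition no_rainbow_path k := forall u w A U,
  walk u w A U -> uniq A -> uniq U -> size A = k -> False.

(** The vertices of the cycle form one block. Degrees inside and outside it give [h <= m] and
    [h <= n - m], hence [n = h.*2] and equality in all degree bounds. *)
Lemma rainbow_cycle_two_blocks m (w : nat -> V) c : 0 < m -> m < n -> rainbow_cycle m w c ->
  no_rainbow_path m.*2.+1 -> two_blocks.
Proof.
move=> m0 mn Hc noP; have [H1 H2 H3 H4 H5] := Hc.
pose S := [set z in seg w 0 m.*2].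
have mS z : (z \in S) = (z \in seg w 0 m.*2) by rewrite inE.
have wS k : w k \in S.
  by rewrite mS -(perm_mem (perm_seg_period k H2)); apply: mem_seg; nat_lia.
have mS_ex u : u \in S -> exists r, u = w r by rewrite mS => /segP[r _ ->]; exists r.
have card_le (b : bool) : #|[set z in S | side z == b]| <= m.
  apply: leq_trans (rainbow_cycle_card_side_le b Hc); apply/eq_leq/eq_card => z.
  by rewrite !inE.
have card_sum (b : bool) : #|[set z in S | side z == b]| + #|[set z in S | side z == ~~ b]| = m.*2.
  have <- : #|S| = m.*2.
    have -> : #|S| = #|seg w 0 m.*2| by apply: eq_card => z; rewrite inE.
    by rewrite (card_uniqP H4) size_seg subn0.
  have <- := cardsID [set z | side z == b] S; congr addn; apply: eq_card => z; rewrite !inE //.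
  by rewrite andbC; congr andb; case: b; case: side.
have cardS (b : bool) : #|[set z in S | side z == b]| = m.
  by have := card_sum b; have := card_le b; have := card_le (~~ b); nat_lia.
have cardSC (b : bool) : #|[set z in ~: S | side z == b]| = n - m.
  rewrite -(card_side b) -(cardS b) -(cardsID S [set z | side z == b]).
  rewrite (_ : [set z | side z == b] :&: S = [set z in S | side z == b]); last first.
    by apply/setP => z; rewrite !inE andbC.
  rewrite addKn; apply: eq_card => z; by rewrite !inE.
have [|a aN] := @uncoloured (seg c 0 m.*2); first by rewrite size_seg; nat_lia.
(* The colouring [c'] is arbitrary so that this serves both for the cycle as given and for its
   recolouring. *)
have leaving r d (c' : nat -> C) z : (forall k, k.+1 < m.*2 -> E (c' k) (w (k + r)) (w (k.+1 + r))) ->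
    uniq (d :: seg c' 0 m.*2.-1) -> E d (w r) z -> z \in S.
  move=> Hc' uc Ez; apply: contraT => zS.
  have W := @walk_seg_pred _ _ E (fun k => w (k + r)) c' 0 m.*2 ltac:(nat_lia) (fun k _ kM => Hc' k kM).
  rewrite Esym in Ez; case: (noP _ _ _ _ (walk_step Ez W)) => //.
    rewrite cons_uniq seg_shift add0n [_ + r]addnC (perm_uniq (perm_seg_period r H2)) H4 andbT.
    by rewrite (perm_mem (perm_seg_period r H2)) -mS.
  by rewrite /= size_seg subn0.
have closed_a u z : u \in S -> E a u z -> z \in S.
  case/mS_ex=> r -> ; apply: (leaving r a (fun k => c (k + r))) => [k _|]; first exact: H1.
  have P := perm_seg_period r H3; rewrite addnC -[X in seg c X _]add0n -seg_shift in P.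
  have : uniq (a :: seg (fun k => c (k + r)) 0 m.*2) by rewrite /= (perm_uniq P) (perm_mem P) aN H5.
  by rewrite (@seg_split _ _ m.*2.-1) ?leq_pred // -cat_cons cat_uniq => /andP[].
have closedC d : (forall u z, u \in S -> E d u z -> z \in S) ->
    forall u z, u \notin S -> E d u z -> z \notin S.
  by move=> cl u z uS; rewrite Esym => Ez; apply: contra uS => /cl; apply.
have sub_N d u (T : {set V}) : (forall z, E d u z -> z \in T) ->
    [set z | E d u z] \subset [set z in T | side z == ~~ side u].
  by move=> HT; apply/subsetP => z; rewrite !inE => Ez; rewrite (HT _ Ez) (Eside Ez) eqxx.
have hm : h <= m.
  rewrite -(cardS (~~ side (w 0))); apply: leq_trans (Edeg a (w 0)) (subset_leq_card _).
  by apply: sub_N => z; apply: closed_a.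
have hnm : h <= n - m.
  have [x sx xN] := rainbow_cycle_outside true mn Hc.
  rewrite -(cardSC (~~ side x)); apply: leq_trans (Edeg a x) (subset_leq_card _).
  by apply: sub_N => z Ez; rewrite inE; apply: closedC Ez; [exact: closed_a|rewrite mS].
have mh : m = h by nat_lia.
have EP d : (forall u z, u \in S -> E d u z -> z \in S) ->
    forall u z, E d u z = (side u != side z) && ((u \in S) == (z \in S)).
  move=> cl u z; apply/idP/andP => [Ez|[suz]].
    split; first by rewrite (Eside Ez); case: side.
    case uS : (u \in S); first by rewrite (cl _ _ uS Ez).
    by rewrite (negbTE (closedC _ cl _ _ (negbT uS) Ez)).
  have full (T : {set V}) : #|[set z in T | side z == ~~ side u]| = h ->
      (forall z, E d u z -> z \in T) -> z \in T -> E d u z.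
    move=> cT HT zT; have : z \in [set z in T | side z == ~~ side u].
      by rewrite inE zT; move: suz; case: side; case: side.
    have <- : [set z | E d u z] = [set z in T | side z == ~~ side u].
      by apply/eqP; rewrite eqEcard sub_N //= cT Edeg.
    by rewrite inE.
  case uS : (u \in S) => /eqP /esym zS.
    by apply: (full S) => // [|x]; [rewrite cardS|apply: cl].
  apply: (full (~: S)) => [|x Ex|]; first by rewrite cardSC; nat_lia.
    by rewrite inE; apply: closedC Ex; rewrite ?uS.
  by rewrite inE zS.
exists S; split; [nat_lia|by move=> b; rewrite cardS|move=> d]; apply: (EP).
have [->//|da] := eqVneq d a.
move=> u z /mS_ex[r ->].
pose f e := if e == d then a else e.
apply: (leaving r d (fun k => f (c (k + r)))) => [k _|].
  rewrite /f; case: eqP => _; last exact: H1.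
  by rewrite (EP a closed_a) !wS eqxx andbT (Eside (H1 (k + r))); case: side.
have P := perm_seg_period r H3; rewrite addnC -[X in seg c X _]add0n -seg_shift in P.
have ua : uniq (a :: seg (fun k => c (k + r)) 0 m.*2) by rewrite /= (perm_uniq P) (perm_mem P) aN H5.
move: ua; rewrite (@seg_split _ _ m.*2.-1) ?leq_pred // -cat_cons cat_uniq => /andP[/andP[aN' uc] _].
have -> : seg (fun k => f (c (k + r))) 0 m.*2.-1 = map f (seg (fun k => c (k + r)) 0 m.*2.-1).
  by rewrite !segE -map_comp.
rewrite cons_uniq; apply/andP; split.
  by apply/mapP => -[e _]; rewrite /f; case: (eqVneq e d) => [_|ne] /eqP; rewrite ?(negbTE da) // eq_sym (negbTE ne).
rewrite map_inj_in_uniq // => e1 e2 e1s e2s; rewrite /f.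
case: (eqVneq e1 d) => [->|_]; case: (eqVneq e2 d) => [->|_] // e.
  by rewrite e e2s in aN'.
by rewrite -e e1s in aN'.
Qed.

Lemma rainbow_seg u w A U : walk u w A U -> uniq A -> uniq U ->
  exists v c, [/\ forall k, k.+1 < size A -> E (c k) (v k) (v k.+1),
    uniq (seg v 0 (size A)) & uniq (seg c 0 (size A).-1)].
Proof.
move=> W uA uU; have /card_gt0P[d _] : 0 < #|C| by nat_lia.
have [v [c [HA HU _ _ He]]] := walkE d W; have sA := walk_size W.
by exists v, c; rewrite sA /= -HA -HU.
Qed.

Lemma even_two_blocks m v c : 0 < m -> m < n ->
  (forall k, k.+1 < m.*2 -> E (c k) (v k) (v k.+1)) ->
  uniq (seg v 0 m.*2) -> uniq (seg c 0 m.*2.-1) ->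
  no_rainbow_path m.*2.+1 -> two_blocks.
Proof.
move=> m0 mn H1 H2 H3 noP.
have [|a aN] := @uncoloured (seg c 0 m.*2.-1); first by rewrite size_seg; nat_lia.
have [|b bN] := @uncoloured (a :: seg c 0 m.*2.-1); first by rewrite -ltnS cardC /= size_seg; nat_lia.
rewrite inE negb_or in bN; have /andP[ba bN'] := bN.
have Wseg i j : i < j -> j <= m.*2 -> walk (v i) (v j.-1) (seg v i j) (seg c i j.-1).
  by move=> ij jM; apply: walk_seg_pred => // k *; apply: H1; nat_lia.
have W := Wseg 0 m.*2 ltac:(nat_lia) (leqnn _).
have inner u w A U d z : walk u w A U -> perm_eq A (seg v 0 m.*2) -> perm_eq U (seg c 0 m.*2.-1) ->
    d \notin seg c 0 m.*2.-1 -> E d u z -> exists2 k, k < m.*2 & z = v k.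
  move=> WA pA pU dN Ez; suff /segP[k kM zk] : z \in seg v 0 m.*2 by exists k.
  apply: contraT => zN; rewrite Esym in Ez.
  case: (noP _ _ _ _ (walk_step Ez WA)) => //.
  - by rewrite /= (perm_mem pA) zN (perm_uniq pA).
  - by rewrite /= (perm_mem pU) dN (perm_uniq pU).
  - by rewrite /= (perm_size pA) size_seg subn0.
have hp : h <= count (fun k => E a (v 0) (v k.*2.+1)) (iota 0 m).
  apply: (@count_neighbours a (v 0) (fun k => v k.*2.+1)) => z Ez.
  have [k km zk] := inner _ _ _ _ _ _ W (perm_refl _) (perm_refl _) aN Ez.
  have := Eside Ez; rewrite zk (side_path H1) // => ok.
  have {}ok : odd k by move: ok; case: side; case: odd.
  have ek : k./2.*2.+1 = k by nat_lia.
  by exists k./2; split; rewrite ?ek -?zk //; nat_lia.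
have hq : h <= count (fun k => E b (v m.*2.-1) (v k.*2)) (iota 0 m).
  apply: (@count_neighbours b (v m.*2.-1) (fun k => v k.*2)) => z Ez.
  have [||k km zk] := inner _ _ _ _ _ _ (walk_rev Esym W) _ _ bN' Ez; rewrite ?perm_rev //.
  have lM : m.*2.-1 < m.*2 by nat_lia.
  have om : odd m.*2.-1 by nat_lia.
  have := Eside Ez; rewrite zk (side_path H1 km) (side_path H1 lM) om.
  move=> ok; have {}ok : ~~ odd k by move: ok; case: side; case: odd.
  have ek : k./2.*2 = k by nat_lia.
  by exists k./2; split; rewrite ?ek -?zk //; nat_lia.
have [|k [km Pk Qk]] := @count_overlap _ _ (iota 0 m) h h _ hp hq; first by rewrite size_iota; nat_lia.
rewrite mem_iota add0n in km.
have W1 := walk_rev Esym (Wseg 0 k.*2.+1 ltac:(nat_lia) ltac:(nat_lia)).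
have W2 := Wseg k.*2.+1 m.*2 ltac:(nat_lia) ltac:(nat_lia).
have uC : uniq (b :: a :: seg c 0 m.*2.-1) by rewrite /= inE negb_or ba bN' aN.
have [||| w' [c' Hc]] := @closed_walk_rainbow_cycle m _ _ _ _ _ (walk_cat W1 Pk W2) Qk.
- rewrite (perm_uniq (_ : perm_eq _ (seg v 0 m.*2))) //; apply/permP => p.
  by rewrite !countE (@count_seg_split _ _ v k.*2.+1 0 m.*2) /=; nat_lia.
- apply/uniq_countP => z; apply: leq_trans (elimT (uniq_countP _) uC z).
  by rewrite !countE (@count_seg_split _ _ c k.*2 0 m.*2.-1) ?(@count_seg_cons _ _ c k.*2) /=; nat_lia.
- by rewrite size_cat size_rev !size_seg; nat_lia.
exact: rainbow_cycle_two_blocks Hc noP.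
Qed.

Lemma odd_extend m v c : m.+1 < n ->
  (forall k, k.+1 < m.*2.+1 -> E (c k) (v k) (v k.+1)) ->
  uniq (seg v 0 m.*2.+1) -> uniq (seg c 0 m.*2) -> ~ no_rainbow_path m.*2.+2.
Proof.
move=> mn H1 H2 H3 noP.
have [|a aN] := @uncoloured (seg c 0 m.*2); first by rewrite size_seg; nat_lia.
have [|b bN] := @uncoloured (a :: seg c 0 m.*2); first by rewrite -ltnS cardC /= size_seg; nat_lia.
rewrite inE negb_or in bN; have /andP[ba bN'] := bN.
have uC : uniq (b :: a :: seg c 0 m.*2) by rewrite /= inE negb_or ba bN' aN.
have [|y sy yN] := @path_outside v c m m.*2.+1 _ (leqnn _) H1; first by nat_lia.
have Wseg i j : i < j -> j <= m.*2.+1 -> walk (v i) (v j.-1) (seg v i j) (seg c i j.-1).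
  by move=> ij jM; apply: walk_seg_pred => // k *; apply: H1; nat_lia.
have W := Wseg 0 m.*2.+1 (ltn0Sn _) (leqnn _).
have inj_v i j : i < m.*2.+1 -> j < m.*2.+1 -> v i = v j -> i = j.
  by move=> iM jM; apply: (seg_inj H2).
pose K := [set k : 'I_m | E a (v 0) (v k.*2.+1)].
(* Neighbours of [y] may lie off the path, so vertices are counted here instead of indices: two sets
   of size at least [h] within the [n.-1] vertices of [X] must meet. At [v m.*2] the vertex [y]
   could be attached directly. *)
pose X := [set z | side z == side (v 0)] :\ v m.*2.
have sv k : k <= m -> side (v k.*2) = side (v 0).
  by move=> km; rewrite (side_path H1) ?odd_double ?addbF //; nat_lia.
have cardX : #|X| = n.-1.
  by have := card_side (side (v 0)); rewrite (cardsD1 (v m.*2)) inE sv // eqxx add1n => <-.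
have KX : [set v k.*2 | k : 'I_m in K] \subset X.
  apply/subsetP => _ /imsetP[k _ ->]; rewrite !inE sv ?eqxx ?andbT; last by apply: ltnW.
  apply/eqP => ev; have km := ltn_ord k.
  have e : k.*2 = m.*2 by apply: inj_v ev; nat_lia.
  nat_lia.
have hK : h <= #|[set v k.*2 | k : 'I_m in K]|.
  rewrite card_in_imset => [|i j _ _ ev]; last first.
    have im := ltn_ord i; have jm := ltn_ord j.
    have e : i.*2 = j.*2 by apply: inj_v ev; nat_lia.
    by apply: val_inj; apply: double_inj.
  apply: leq_trans (Edeg a (v 0)) (leq_trans (subset_leq_card _) (leq_imset_card (fun k : 'I_m => v k.*2.+1) K)).
  apply/subsetP => z; rewrite inE => Ez; have sz := Eside Ez.
  have /segP[k kM zk] : z \in seg v 0 m.*2.+1.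
    apply: contraT => zN; rewrite Esym in Ez.
    case: (noP _ _ _ _ (walk_step Ez W)) => //=; rewrite ?zN ?aN //.
    by rewrite size_seg subn0.
  have ok : odd k by move: sz; rewrite zk (side_path H1) //; case: side; case: odd.
  have km : k./2 < m by nat_lia.
  have ek : k./2.*2.+1 = k by nat_lia.
  by apply/imsetP; exists (Ordinal km); rewrite ?inE /= ek -?zk.
have NX : [set z | E b y z] \subset X.
  apply/subsetP => z; rewrite !inE => Ez; rewrite (Eside Ez) sy negbK eqxx andbT.
  apply/eqP => zv; rewrite {}zv in Ez.
  case: (noP _ _ _ _ (walk_step Ez (walk_rev Esym W))) => //=; rewrite ?mem_rev ?rev_uniq ?yN ?bN' //.
  by rewrite size_rev size_seg subn0.
have : 0 < #|[set v k.*2 | k : 'I_m in K] :&: [set z | E b y z]|.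
  have := cardsUI [set v k.*2 | k : 'I_m in K] [set z | E b y z].
  have : [set v k.*2 | k : 'I_m in K] :|: [set z | E b y z] \subset X by rewrite subUset KX.
  by move/subset_leq_card; rewrite cardX; have := Edeg b y; nat_lia.
case/card_gt0P => z; rewrite !inE => /andP[/imsetP[k kK ->]]; rewrite inE in kK => Eb.
have km := ltn_ord k.
have W1 := walk_rev Esym (Wseg 0 k.*2.+1 (ltn0Sn _) ltac:(nat_lia)).
have W2 := Wseg k.*2.+1 m.*2.+1 ltac:(nat_lia) (leqnn _).
have uA : uniq (y :: seg v 0 m.*2.+1) by rewrite /= yN.
apply: (noP _ _ _ _ (walk_step Eb (walk_cat W1 kK W2))).
- apply/uniq_countP => x; apply: leq_trans (elimT (uniq_countP _) uA x).
  by rewrite !countE (@count_seg_split _ _ v k.*2.+1 0 m.*2.+1) /=; nat_lia.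
- apply/uniq_countP => x; apply: leq_trans (elimT (uniq_countP _) uC x).
  by rewrite !countE (@count_seg_split _ _ c k.*2 0 m.*2) ?(@count_seg_cons _ _ c k.*2) /=; nat_lia.
- by rewrite /= size_cat size_rev !size_seg; nat_lia.
Qed.

(** Without two blocks, rainbow paths grow one vertex at a time: an even [k] is handled by
    [even_two_blocks], an odd [k] below [n.*2.-1] by [odd_extend], and [k = n.*2.-1] by
    [gap1_path_false]. *)
Lemma no_hamiltonian_two_blocks : two_blocks.
Proof.
apply: NNPP => no2.
have ext k : 0 < k -> k < n.*2 -> ~ no_rainbow_path k -> ~ no_rainbow_path k.+1.
  move=> k0 kn ex noP; apply: ex => u w A U W uA uU sA.
  have [v [c [H1 H2 H3]]] := rainbow_seg W uA uU; rewrite {}sA in H1 H2 H3.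
  case ok : (odd k); last first.
    have ek : k = k./2.*2 by nat_lia.
    by rewrite ek in H1 H2 H3 noP; apply: no2; apply: even_two_blocks H1 H2 H3 noP; nat_lia.
  have ek : k = k./2.*2.+1 by nat_lia.
  rewrite ek in H1 H2 H3 noP.
  have [lt|ge] := ltnP k./2.+1 n; first exact: odd_extend lt H1 H2 H3 noP.
  have nE : n = k./2.+1 by nat_lia.
  have [|y sy yN] := @path_outside v c k./2 k./2.*2.+1 _ (leqnn _) H1; first by nat_lia.
  have [|a aN] := @uncoloured (seg c 0 k./2.*2); first by rewrite size_seg; nat_lia.
  apply: (@gap1_path_false k./2 v c a y nE); split=> //.
  - by rewrite /= yN.
  - by rewrite /= aN.
have all k : 0 < k -> k <= n.*2 -> ~ no_rainbow_path k.
  elim: k => // -[|k] IH _ kn; last by apply: ext => //; apply: IH; nat_lia.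
  have /card_gt0P[u _] : 0 < #|V| by rewrite cardV double_gt0.
  by move/(_ u u [:: u] [::]); apply => //; apply: walk_one.
apply: (all n.*2); rewrite ?double_gt0 // => u w A U W uA uU sA.
by apply: noham; exists u, w, A, U.
Qed.

End RainbowPaths.

(** * Graphs and transversals *)

Lemma graph_eq (V : finType) (G1 G2 : graph V) :
  vertices G1 = vertices G2 -> edges G1 = edges G2 -> G1 = G2.
Proof.
case: G1 => v1 e1 p1; case: G2 => v2 e2 p2 /= ev ee; rewrite ev ee in p1 p2 *.
by congr Graph; apply: bool_irrelevance.
Qed.

Lemma geq_bigmin (T : finType) (d : nat) (A : {set T}) (F : T -> nat) u : u \in A ->
  \big[minn/d]_(v in A) F v <= F u.
Proof.
move=> uA; have := mem_index_enum u; elim: (index_enum T) => // z s IH.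
rewrite inE big_cons => /orP[/eqP<-|us]; first by rewrite uA geq_minl.
by case: ifP => _; [apply: leq_trans (geq_minr _ _) _|]; apply: IH.
Qed.

Lemma complete_graph_axiom (V : finType) (A B : {set V}) : [disjoint A & B] ->
  [forall e in [set [set a; b] | a in A, b in B], (e \subset A :|: B) && (#|e| == 2)].
Proof.
move=> dAB; apply/forall_inP => _ /imset2P[a b aA bB ->].
rewrite subUset !sub1set !inE aA bB orbT /= cards2.
by case: (eqVneq a b) => // e; move/disjointFr: dAB => /(_ _ aA); rewrite e bB.
Qed.

Section Translation.
Variables (V : finType) (s : nat) (G : 'I_s -> graph V).

Definition adjacent i u z := [set u; z] \in edges (G i).

Definition edge_seq (A : seq V) := [seq [set p.1; p.2] | p <- zip A (behead A)].

Lemma adjacent_neq i u z : adjacent i u z -> u != z.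
Proof.
have /forall_inP := graph_axiom (G i); rewrite /adjacent => H /H /andP[_].
by rewrite cards2; case: (eqVneq u z).
Qed.

Lemma size_edge_seq A : size (edge_seq A) = (size A).-1.
Proof. by case: A => //= u A; rewrite size_map size_zip /=; lia. Qed.

Lemma edge_seq_sub (A : seq V) e u : e \in edge_seq A -> u \in e -> u \in A.
Proof.
case/mapP => -[p q] /= + ->; elim: A => //= a [|b A] //= IH; rewrite inE => /orP[/eqP[-> ->]|pq pu].
  by rewrite !inE => /orP[] ->; rewrite ?orbT.
by rewrite inE (IH pq pu) orbT.
Qed.

Lemma uniq_edge_seq (A : seq V) : uniq A -> uniq (edge_seq A).
Proof.
elim: A => // a [|b A] //= IH /andP[aA uA]; rewrite -/(edge_seq (b :: A)) IH // andbT.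
by apply: contra aA => /edge_seq_sub; apply; rewrite !inE eqxx.
Qed.

Lemma walk_edge_seq u w A U i k : walk adjacent u w A U -> k < size U ->
  nth set0 (edge_seq A) k \in edges (G (nth i U k)).
Proof.
move=> W; elim: W k => // d x y z A0 U0 Exy W IH k.
have [A' eA] := walk_head W; rewrite eA in IH *.
by case: k => [|k] //=; apply: IH.
Qed.

(** The edges of a path are distinct, so each can be sent to the colour at its position; distinct
    colours make this injective. *)
Lemma transversal_of_walk u w A U : walk adjacent u w A U -> uniq A -> uniq U ->
  size U = s -> (forall z, z \in A) ->
  exists P : graph V, [/\ is_path P, vertices P = [set: V] & graph_transversal G P].
Proof.
move=> W uA uU sU cA; have sA := walk_size W.
have sL : size (edge_seq A) = size U by rewrite size_edge_seq sA.
have eG e : e \in edge_seq A -> exists i, e \in edges (G i).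
  move=> eA; have k : index e (edge_seq A) < size U by rewrite -sL index_mem.
  case: U sU k uU W sA sL => // i U' sU k uU W sA sL.
  by exists (nth i (i :: U') (index e (edge_seq A))); rewrite -{1}(nth_index set0 eA) (walk_edge_seq _ W).
have ax : [forall e in [set e in edge_seq A], (e \subset [set: V]) && (#|e| == 2)].
  apply/forall_inP => e; rewrite inE => /eG[i ei].
  by have /forall_inP/(_ _ ei)/andP[_ ->] := graph_axiom (G i); rewrite subsetT.
exists (Graph ax); split => //.
  exists A; split => //; first by case: A sA {W uA cA sL eG ax}.
  by apply/setP => z; rewrite !inE cA.
split; first by rewrite /= cardsE (card_uniqP (uniq_edge_seq uA)) sL.
have mem_e (e : {e : {set V} | e \in edges (Graph ax)}) : val e \in edge_seq A.
  by have := valP e; rewrite inE.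
have lt_e (e : {e : {set V} | e \in edges (Graph ax)}) : index (val e) (edge_seq A) < size U by rewrite -sL index_mem; apply: mem_e.
(* A default for [nth]: an edge of the path forces [s] to be positive. *)
have i0 : {e : {set V} | e \in edges (Graph ax)} -> 'I_s.
  by move=> e; apply: (Ordinal (n := s) (m := 0)); rewrite -sU; apply: leq_ltn_trans (lt_e e).
exists (fun e => nth (i0 e) U (index (val e) (edge_seq A))); split=> [e f /=|e].
  rewrite (set_nth_default (i0 f) (i0 e) (lt_e e)) => /eqP; rewrite (nth_uniq _ (lt_e e) (lt_e f) uU) => /eqP.
  by move/(congr1 (nth set0 (edge_seq A))); rewrite !nth_index ?mem_e // => /val_inj.
by rewrite -{1}(nth_index set0 (mem_e e)) (walk_edge_seq _ W).
Qed.

End Translation.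

Theorem theorem1p3 (n : nat) (hn : 0 < n) (V : finType) (X Y : {set V})
    (hXY : X :|: Y = [set: V]) (hX : #|X| = n) (hY : #|Y| = n)
    (G : 'I_(2 * n - 1) -> graph V)
    (hG : forall i, bipartite_on X Y (G i))
    (hdeg : forall i, uphalf n <= min_degree (G i)) :
  (exists P : graph V,
     [/\ is_path P, vertices P = [set: V] & graph_transversal G P])
  \/
  (~~ odd n /\
   exists H : graph V, two_complete_bipartite X Y (n./2) H /\ forall i, G i = H).
Proof.
pose E := adjacent G; pose side z := z \in X.
have i0 : 'I_(2 * n - 1) by apply: (Ordinal (m := 0)); lia.
have [dXY _ _] := hG i0.
have mY z : (z \in Y) = (z \notin X).
  have : z \in X :|: Y by rewrite hXY inE.
  rewrite inE; case zX : (z \in X) => /= => [_|->] //.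
  by rewrite (disjointFr dXY zX).
have Esym i : symmetric (E i) by move=> u z; rewrite /E /adjacent setUC.
have Eside i u z : E i u z -> side z = ~~ side u.
  move=> Ez; have [_ _ /(_ _ Ez)[x [y [xX yY e]]]] := hG i.
  have uz := adjacent_neq Ez; rewrite mY in yY.
  have : u \in [set x; y] by rewrite -e !inE eqxx.
  have : z \in [set x; y] by rewrite -e !inE eqxx orbT.
  rewrite /side !inE => /orP[] /eqP ez /orP[] /eqP eu; move: uz; rewrite ez eu ?eqxx //.
    by rewrite xX (negbTE yY).
  by rewrite xX (negbTE yY).
have Edeg i u : uphalf n <= #|[set z | E i u z]|.
  have [_ vG eG] := hG i.
  apply: leq_trans (hdeg i) (leq_trans (@geq_bigmin _ _ _ (degree (G i)) u _) _).
    by rewrite vG hXY inE.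
  (* Every edge at [u] is the image [[set u; z]] of some neighbour [z]. *)
  apply: leq_trans (leq_imset_card (fun z => [set u; z]) _).
  apply/subset_leq_card/subsetP => e; rewrite inE => /andP[ee ue].
  have [x [y [xX yY e2]]] := eG _ ee; apply/imsetP.
  move: ue; rewrite e2 !inE => /orP[] /eqP eu.
    by exists y; rewrite eu // inE /E /adjacent -e2.
  by exists x; rewrite eu; [rewrite inE /E /adjacent setUC -e2|rewrite setUC].
have card_side b : #|[set z | side z == b]| = n.
  case: b; [rewrite -hX|rewrite -hY]; apply: eq_card => z; rewrite inE ?mY /side; by case: (z \in X).
have cardC : #|'I_(2 * n - 1)|.+1 = n.*2 by rewrite card_ord; lia.
have n_le : n <= (uphalf n).*2 by lia.
have [[u [w [A [U [W uA uU sA]]]]]|noham] := classic (rainbow_hamiltonian E n).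
  left; apply: (transversal_of_walk W uA uU); first by apply: succn_inj; rewrite -(walk_size W) sA; nat_lia.
  by move=> z; apply: (mem_full card_side).
right; have [S [n2 cardS EP]] := no_hamiltonian_two_blocks Esym Eside Edeg card_side cardC n_le hn noham.
have hn2 : n./2 = uphalf n by lia.
split; first by lia.
have dis (T : {set V}) : [disjoint X :&: T & Y :&: T].
  by rewrite -setI_eq0; apply/eqP/setP => z; rewrite !inE mY; case: (z \in X); rewrite ?andbF.
pose K (T : {set V}) := Graph (complete_graph_axiom (dis T)).
(* By [EP] adjacency does not depend on the colour, so any one of the graphs can serve as [H]; its
   blocks are cut out by [S] and its complement. *)
exists (G i0); split; last first.
  move=> i; apply: graph_eq; first by have [_ -> _] := hG i; have [_ -> _] := hG i0.
  apply/setP => e; apply/idP/idP => ee.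
    have [_ _ /(_ _ ee)[x [y [_ _ e2]]]] := hG i; rewrite e2 in ee *.
    by have := ee; rewrite -!/(adjacent G _ _ _) -!/(E _ _ _) !EP.
  have [_ _ /(_ _ ee)[x [y [_ _ e2]]]] := hG i0; rewrite e2 in ee *.
  by have := ee; rewrite -!/(adjacent G _ _ _) -!/(E _ _ _) !EP.
have cS b : #|[set z in S | side z == b]| = n./2 by rewrite hn2 cardS.
have cSC b : #|[set z in ~: S | side z == b]| = n./2.
  have := card_side b; rewrite -(cardsID S) (_ : _ :&: S = [set z in S | side z == b]).
    rewrite cS (_ : _ :\: S = [set z in ~: S | side z == b]); first by lia.
    by apply/setP => z; rewrite !inE.
  by apply/setP => z; rewrite !inE andbC.
have cX (T : {set V}) : X :&: T = [set z in T | side z == true].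
  by apply/setP => z; rewrite !inE /side eqb_id andbC.
have cY (T : {set V}) : Y :&: T = [set z in T | side z == false].
  by apply/setP => z; rewrite !inE /side mY andbC; case: (z \in X).
exists (X :&: S), (Y :&: S), (X :&: ~: S), (Y :&: ~: S), (K S), (K (~: S)); split.
- by rewrite !subsetIl.
- by rewrite !cX !cY !cS !cSC.
- by split=> //; apply: dis.
- by split=> //; apply: dis.
split.
- rewrite -setI_eq0; apply/eqP/setP => z; rewrite !inE.
  by case: (z \in S); rewrite ?andbF.
- have [_ -> _] := hG i0; apply/setP => z; rewrite !inE.
  by case: (z \in S); rewrite ?andbT ?andbF ?orbF.
apply/setP => e; apply/idP/idP => [ee|].
  have [_ _ /(_ _ ee)[x [y [xX yY e2]]]] := hG i0; rewrite {}e2 in ee *.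
  have := ee; rewrite -/(adjacent G _ _ _) -/(E _ _ _) EP => /andP[_ /eqP xyS].
  rewrite inE; apply/orP; case xS : (x \in S); rewrite xS in xyS; [left|right].
    by apply/imset2P; exists x y; rewrite // inE ?xX ?yY -?xyS.
  by apply/imset2P; exists x y; rewrite // !inE ?xX ?yY ?xS -?xyS.
rewrite inE => /orP[] /imset2P[x y]; rewrite !inE => /andP[xX xS] /andP[yY yS] ->;
  rewrite -/(adjacent G _ _ _) -/(E _ _ _) EP /side xX.
  by rewrite mY in yY; rewrite (negbTE yY) xS yS.
by rewrite mY in yY; rewrite (negbTE yY) (negbTE xS) (negbTE yS).
Qed.
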